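(* Let $n,k\in\mathbb{N}$, $\alpha\in(0,1]$, and let $\Omega\subseteq\mathbb{R}^n$ be open. Then: (a) $\mathcal{M}^{k+\alpha}L^\infty(\Omega,\#)\hookrightarrow C_{\mathrm b}^{k,\alpha}(\overline{\Omega})$. (b) If there exists a bounded extension operator $\mathsf{E}\colon C_{\mathrm b}^{k,\alpha}(\overline{\Omega})\to C_{\mathrm b}^{k,\alpha}(\overline{\mathbb{R}^n})$, then $C_{\mathrm b}^{k,\alpha}(\overline{\Omega})\cong\mathcal{M}^{k+\alpha}L^\infty(\Omega,\#)$.
   Context: Norms on Euclidean spaces are Euclidean; $0\cdot\infty=0$. $X\hookrightarrow Y$ means $X\subseteq Y$ with $\|f\|_Y\le C\|f\|_X$ for some constant $C$ and all $f\in X$; $X\cong Y$ means both $X\hookrightarrow Y$ and $Y\hookrightarrow X$. $\#$ is the counting measure on $(\Omega,2^\Omega)$, so $L^\infty(\Omega,\#)$ is the space of bounded functions $\Omega\to\mathbb{R}$ with the supremum norm. $[m]=\{1,\dots,m\}$, $[0]=\emptyset$. Let $m\in\mathbb{N}$, $s\in(m-1,m]$, $\mathbf{x}=\{x_I\}_{I\subseteq[m]}\subseteq\mathbb{R}^n$. For $S\subseteq[m]$ and $A\subseteq[m]\setminus S$ put $\mathsf{P}^S_A(\mathbf{x})=\|\sum_{I\subseteq S}(-1)^{|S\setminus I|}x_{I\cup A}\|$, $\mathsf{P}^S(\mathbf{x})=\sum_{A\subseteq[m]\setminus S}\mathsf{P}^S_A(\mathbf{x})$; for $j\in[m-1]$,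 $\mathsf{P}^j(\mathbf{x})=\sum_{\mathcal{P}}\prod_{S\in\mathcal{P}}\mathsf{P}^S(\mathbf{x})$, the sum over partitions $\mathcal{P}$ of $[m]$ into exactly $j$ nonempty blocks; $\mathsf{P}^s(\mathbf{x})=\mathsf{P}^{\{m\}}(\mathbf{x})^{s-m+1}\prod_{j=1}^{m-1}\mathsf{P}^{\{j\}}(\mathbf{x})$; $\mathsf{P}^{\langle s\rangle}(\mathbf{x})=\mathsf{P}^s(\mathbf{x})+\sum_{j=1}^{m-1}\mathsf{P}^j(\mathbf{x})$. For $f\colon\Omega\to\mathbb{R}$, $\mathbb{D}^s(f)$ is the family of $G\colon\Omega\to[0,\infty]$ with $|\sum_{I\subseteq[m]}(-1)^{|[m]\setminus I|}f(x_I)|\le\mathsf{P}^{\langle s\rangle}(\mathbf{x})\sum_{I\subseteq[m]}G(x_I)$ for all tuples $\mathbf{x}=\{x_I\}_{I\subseteq[m]}\subseteq\Omega$ (everywhere, no exceptional set). $\mathcal{M}^sL^\infty(\Omega,\#)$ is the set of bounded $f\colon\Omega\to\mathbb{R}$ such that $\mathbb{D}^s(f)$ contains a bounded function, with norm $\|f\|_\infty+\inf_{G\in\mathbb{D}^s(f)}\|G\|_\infty$ ($\|\cdot\|_\infty$ the supremum norm). Hölder spaces: for $m\in\mathbb{N}_0$, $\alpha\in(0,1]$, $C^{m,\alpha}(\Omega)$ is the set of $m$-times continuously differentiable $f\colon\Omega\to\mathbb{R}$ with $\nabla^jf$ bounded (and continuous) for all $j\in[m]$ and $[\nabla^mf]_{C^{0,\alpha}(\Omega)}:=\sup_{x\ne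 y\in\Omega}\|\nabla^mf(x)-\nabla^mf(y)\|/\|x-y\|^\alpha<\infty$; its seminorm is $[f]_{C^{m,\alpha}(\Omega)}=\sum_{j=1}^m\|\nabla^jf\|_\infty+[\nabla^mf]_{C^{0,\alpha}(\Omega)}$. $C_{\mathrm b}^{m,\alpha}(\overline{\Omega})$ is the set of $f\in C^{m,\alpha}(\Omega)$ such that for each $j\in\{0,1,\dots,m\}$, $\nabla^jf$ (with $\nabla^0f=f$) extends to a bounded continuous function on $\overline{\Omega}$; its norm is $\|f\|_\infty+[f]_{C^{m,\alpha}(\Omega)}$. A bounded extension operator $\mathsf{E}\colon C_{\mathrm b}^{k,\alpha}(\overline{\Omega})\to C_{\mathrm b}^{k,\alpha}(\overline{\mathbb{R}^n})$ is a (not necessarily linear) map with, for some $C>0$, $\mathsf{E}(f)|_\Omega=f$ and $\|\mathsf{E}(f)\|\le C\|f\|$ for all $f$ in its domain. *)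

(* Defs.v *)
From HB Require Import structures.
From mathcomp Require Import all_boot all_order all_algebra.
From mathcomp Require Import all_classical all_reals all_analysis.
Set Implicit Arguments.
Unset Strict Implicit.
Unset Printing Implicit Defensive.
Import Order.TTheory GRing.Theory Num.Theory.
Import numFieldNormedType.Exports.
Local Open Scope ring_scope.

(* The library norm on ['rV[R]_p] is the sup norm.  It induces the usual
   topology, so [open], [closure], [continuous] and [differentiable] can be
   used as they are, but every metric quantity is written with [enorm]. *)
Definition enorm (R : realType) (p : nat) (v : 'rV[R]_p) : R :=
  Num.sqrt (\sum_(i < p) v 0 i ^+ 2).

(* Supremum taken in [0, +oo], so that it is 0 over the empty set. *)
Definition supE (R : realType) (T : Type) (A : set T) (h : T -> \bar R)
    : \bar R :=
  ereal_sup ([set 0%E] `|` (h @` A))%classic.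

Definition sup_norm (R : realType) (T : Type) (p : nat) (A : set T)
    (F : T -> 'rV[R]_p) : \bar R :=
  supE A (fun x => (enorm (F x))%:E).

Definition sup_abs (R : realType) (T : Type) (A : set T) (f : T -> R)
    : \bar R :=
  supE A (fun x => `|f x|%:E).

(* A space of real functions on a domain Omega, where a function on Omega is
   represented by any total function agreeing with it on Omega.  Only the
   values of [fnorm] on [carrier] are meaningful. *)
Record fspace (R : realType) (n : nat) := FSpace {
  carrier : set ('rV[R]_n -> R);
  fnorm : ('rV[R]_n -> R) -> \bar R
}.

Definition embeds (R : realType) (n : nat) (X Y : fspace R n) : Prop :=
  (carrier X `<=` carrier Y)%classic /\
  exists C : R, forall f, carrier X f -> (fnorm Y f <= C%:E * fnorm X f)%E.

Definition same_space (R : realType) (n : nat) (X Y : fspace R n) : Prop :=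
  embeds X Y /\ embeds Y X.

(* The index set [m] = {1,...,m} is ['I_m], whose element m is [ord_max] when
   m = k.+1. *)

Definition Pcube (R : realType) (n m : nat) (x : {set 'I_m} -> 'rV[R]_n)
    (S A : {set 'I_m}) : R :=
  enorm (\sum_(I : {set 'I_m} | I \subset S)
           (-1) ^+ #|S :\: I| *: x (I :|: A)).

Definition Pset (R : realType) (n m : nat) (x : {set 'I_m} -> 'rV[R]_n)
    (S : {set 'I_m}) : R :=
  \sum_(A : {set 'I_m} | A \subset ~: S) Pcube x S A.

Definition Ppart (R : realType) (n m : nat) (x : {set 'I_m} -> 'rV[R]_n)
    (j : nat) : R :=
  \sum_(Q : {set {set 'I_m}} |
            finset.partition Q [set: 'I_m]%SET && (#|Q| == j))
    \prod_(S in Q) Pset x S.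

(* Here m = k.+1 and k < s <= k.+1, so [s - k%:R] is the exponent s - m + 1. *)
Definition Ppow (R : realType) (n k : nat) (s : R)
    (x : {set 'I_k.+1} -> 'rV[R]_n) : R :=
  (Pset x [set ord_max]%SET `^ (s - k%:R)) *
  \prod_(j < k.+1 | (j < k)%N) Pset x [set j]%SET.

Definition Pmod (R : realType) (n k : nat) (s : R)
    (x : {set 'I_k.+1} -> 'rV[R]_n) : R :=
  Ppow s x + \sum_(1 <= j < k.+1) Ppart x j.

Definition Dgrad (R : realType) (n k : nat) (s : R) (Omega : set 'rV[R]_n)
    (f : 'rV[R]_n -> R) : set ('rV[R]_n -> \bar R) :=
  fun G =>
    (forall y, Omega y -> (0 <= G y)%E) /\
    forall x : {set 'I_k.+1} -> 'rV[R]_n, (forall I, Omega (x I)) ->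
      (`|\sum_(I : {set 'I_k.+1}) (-1) ^+ #|~: I| * f (x I)|%:E <=
       (Pmod s x)%:E * \sum_(I : {set 'I_k.+1}) G (x I))%E.

(* M^s L^oo(Omega, #) for k < s <= k.+1. *)
Definition MLinf (R : realType) (n k : nat) (s : R) (Omega : set 'rV[R]_n)
    : fspace R n :=
  {| carrier := fun f =>
       (sup_abs Omega f < +oo)%E /\
       exists G, Dgrad k s Omega f G /\ (supE Omega G < +oo)%E;
     fnorm := fun f =>
       (sup_abs Omega f + ereal_inf (supE Omega @` Dgrad k s Omega f))%E |}.

(* Iterated partial derivative along the coordinates listed in [w]. *)
Definition pderiv (R : realType) (n : nat) (w : seq 'I_n)
    (f : 'rV[R]_n -> R) : 'rV[R]_n -> R :=
  foldr (fun (i : 'I_n) (g : 'rV[R]_n -> R) => 'D_(delta_mx 0 i) g) f w.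

(* The tensor of all j-th order partial derivatives, as a vector of length n^j,
   so that [enorm] of it is the Euclidean norm of the tensor. *)
Definition nabla (R : realType) (n j : nat) (f : 'rV[R]_n -> R)
    : 'rV[R]_n -> 'rV[R]_#|{: j.-tuple 'I_n}| :=
  fun x => \row_t pderiv (enum_val t : j.-tuple 'I_n) f x.

Definition Cm (R : realType) (n m : nat) (Omega : set 'rV[R]_n)
    (f : 'rV[R]_n -> R) : Prop :=
  (forall j, (j < m)%N -> forall x, Omega x -> differentiable (nabla j f) x) /\
  (forall j, (j <= m)%N -> ({within Omega, continuous (nabla j f)})%classic).

Definition holder (R : realType) (n p : nat) (alpha : R)
    (Omega : set 'rV[R]_n) (F : 'rV[R]_n -> 'rV[R]_p) : \bar R :=
  supE (fun z : 'rV[R]_n * 'rV[R]_n =>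
          [/\ Omega z.1, Omega z.2 & z.1 <> z.2])
       (fun z => (enorm (F z.1 - F z.2) / (enorm (z.1 - z.2) `^ alpha))%:E).

Definition Cma (R : realType) (n m : nat) (alpha : R) (Omega : set 'rV[R]_n)
    (f : 'rV[R]_n -> R) : Prop :=
  [/\ Cm m Omega f,
      forall j, (1 <= j <= m)%N -> (sup_norm Omega (nabla j f) < +oo)%E
    & (holder alpha Omega (nabla m f) < +oo)%E].

Definition Cma_seminorm (R : realType) (n m : nat) (alpha : R)
    (Omega : set 'rV[R]_n) (f : 'rV[R]_n -> R) : \bar R :=
  (\sum_(1 <= j < m.+1) sup_norm Omega (nabla j f) +
   holder alpha Omega (nabla m f))%E.

Definition bounded_extension (R : realType) (n p : nat) (Omega : set 'rV[R]_n)
    (F : 'rV[R]_n -> 'rV[R]_p) : Prop :=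
  exists g : 'rV[R]_n -> 'rV[R]_p,
    [/\ forall x, Omega x -> g x = F x,
        ({within closure Omega, continuous g})%classic
      & (sup_norm (closure Omega) g < +oo)%E].

(* C_b^{m,alpha} of the closure of Omega, for an open Omega. *)
Definition Cb (R : realType) (n m : nat) (alpha : R) (Omega : set 'rV[R]_n)
    : fspace R n :=
  {| carrier := fun f =>
       Cma m alpha Omega f /\
       forall j, (j <= m)%N -> bounded_extension Omega (nabla j f);
     fnorm := fun f => (sup_abs Omega f + Cma_seminorm m alpha Omega f)%E |}.

(* The first clause makes [E] a map on functions on Omega rather than on their
   representatives. *)
Definition bounded_extension_operator (R : realType) (n m : nat) (alpha : R)
    (Omega : set 'rV[R]_n) (E : ('rV[R]_n -> R) -> ('rV[R]_n -> R)) : Prop :=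
  (forall f g, carrier (Cb m alpha Omega) f -> carrier (Cb m alpha Omega) g ->
     (forall x, Omega x -> f x = g x) -> E f = E g) /\
  exists2 C : R, 0 < C &
    forall f, carrier (Cb m alpha Omega) f ->
      [/\ carrier (Cb m alpha [set: 'rV[R]_n]%classic) (E f),
          forall x, Omega x -> E f x = f x
        & (fnorm (Cb m alpha [set: 'rV[R]_n]%classic) (E f) <=
           C%:E * fnorm (Cb m alpha Omega) f)%E].

(* Main.v *)
Require Import Defs.
From HB Require Import structures.
From mathcomp Require Import all_boot all_order all_algebra.
From mathcomp Require Import all_classical all_reals all_analysis.
From mathcomp Require Import ring lra.
Import Order.TTheory GRing.Theory Num.Theory.
Import numFieldNormedType.Exports.
Local Open Scope ring_scope.
Set Implicit Arguments.
Unset Strict Implicit.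
Unset Printing Implicit Defensive.

(** Both embeddings compare differences of order k + 1 of [f] over arbitrary
    tuples of points with products of differences of the points themselves.

    From the gradient to derivatives.  Parallelepipeds are admissible tuples,
    and for them every difference of the points over two or more directions
    vanishes, so that [Pmod] reduces, up to a constant, to the product of the lengths of
    the steps, the last one raised to the power alpha.  Differences of order at
    most k are reached as well, since a tuple may repeat points: if the last
    step is taken only when a whole block of directions is present, the
    difference of order k + 1 collapses to one of lower order
    ([cdiff_collapse]), and [Pmod] is still bounded by the product of the
    lengths, provided that these are at most one ([Pmod_collapse_le]).  Hence
    all differences of [f] of order at most k are bounded by the product of the
    steps, with a constant that does not see the geometry of the domain, and
    those of order k + 1 have the Hoelder form ([Dgrad_diff_le]).  A function
    whose second differences are O(|h| |h'|^alpha) is differentiable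
    ([differentiable_second_diff]), and its partial derivatives inherit the
    bounds with one step less ([diff_bounded_derive]).  After k rounds the
    derivatives of order at most k are bounded, and the last ones are Hoelder
    continuous on the whole domain, because the last step of a parallelepiped
    may join any two of its points.  All these derivatives are then Hoelder
    continuous, and extend to the closure ([holder_bounded_extension]).

    From derivatives to the gradient.  On the whole space the mean value
    theorem removes one direction of a cube of points at the price of one
    derivative, evaluated on an interpolated cube ([cdiff_mvt]).  The discrete
    Leibniz rule [cdiffM] then distributes the other directions between the
    derivative and the increment of the points; those that fall on the
    increment form a block together with the removed direction.  By induction
    the blocks make up the partitions that occur in [Pmod]
    ([cdiff_comp_holder_le]): the partition into singletons comes with the
    Hoelder bound of the last derivative, and all the others with the bounded
    ones.  A constant is therefore a gradient of the extended function, and a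
    fortiori of [f]; the extension is needed because the interpolated cubes
    leave the domain. *)

(** * Differences over the subsets of a finite set *)

(** The vector whose norm is [Pcube]. It takes values in a module so that the
    same operator applies to a tuple of points and to the values of a function
    at these points (in [R^o]). *)
Definition cdiff (R : pzRingType) (V : lmodType R) (T : finType) (S : {set T})
    (phi : {set T} -> V) (A : {set T}) : V :=
  \sum_(I : {set T} | I \subset S) (-1) ^+ #|S :\: I| *: phi (I :|: A).

Lemma subset_setU1_notin (T : finType) (s : T) (S I : {set T}) : s \notin I ->
  (I \subset s |: S) = (I \subset S).
Proof.
move=> sI; apply/fintype.subsetP/fintype.subsetP => IS x xI;
  last by rewrite !inE IS ?orbT.
by have := IS x xI; rewrite !inE => /orP[/eqP xs|//]; rewrite -xs xI in sI.
Qed.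

Lemma setD1_notin (T : finType) (s : T) (I : {set T}) : s \notin I -> I :\ s = I.
Proof.
move=> sI; apply/finset.setP => x; rewrite !inE.
by case: eqVneq => //= ->; rewrite (negbTE sI).
Qed.

Lemma sum_subsetU1 (T : finType) (V : nmodType) (s : T) (S : {set T})
    (F : {set T} -> V) : s \notin S ->
  \sum_(I : {set T} | I \subset s |: S) F I =
  \sum_(I : {set T} | I \subset S) (F I + F (s |: I)).
Proof.
move=> sS; rewrite (bigID (fun I : {set T} => s \in I)) /= addrC big_split /=.
have nin (I : {set T}) : I \subset S -> s \notin I.
  by move=> IS; apply: contra sS => /(fintype.subsetP IS).
congr (_ + _).
  apply: eq_bigl => I; apply/andP/idP => [[IS sI]|IS].
    by rewrite -(subset_setU1_notin _ sI).
  by rewrite nin// (fintype.subset_trans IS)// subsetU1.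
rewrite (reindex_onto (fun I => s |: I) (fun I => I :\ s)) /=; last first.
  by move=> I /andP[_ sI]; rewrite finset.setD1K.
apply: eq_bigl => I; rewrite setU11 andbT; apply/andP/idP => [[IS /eqP e]|IS].
  have sI : s \notin I by rewrite -e setD11.
  by rewrite -(subset_setU1_notin _ sI) (fintype.subset_trans _ IS)// subsetU1.
by rewrite finset.setUS// setU1K ?nin.
Qed.

Lemma cdiff0 (R : pzRingType) (V : lmodType R) (T : finType)
    (phi : {set T} -> V) (A : {set T}) : cdiff finset.set0 phi A = phi A.
Proof.
rewrite /cdiff (big_pred1 finset.set0) => [|I]; last by rewrite finset.subset0.
by rewrite finset.set0D cards0 expr0 scale1r finset.set0U.
Qed.

Lemma cdiffU1 (R : pzRingType) (V : lmodType R) (T : finType) (s : T)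
    (S : {set T}) (phi : {set T} -> V) (A : {set T}) : s \notin S ->
  cdiff (s |: S) phi A = cdiff S phi (s |: A) - cdiff S phi A.
Proof.
move=> sS; rewrite /cdiff sum_subsetU1// -sumrB; apply: eq_bigr => I IS.
have sI : s \notin I by apply: contra sS => /(fintype.subsetP IS).
have -> : (s |: S) :\: (s |: I) = S :\: I.
  apply/finset.setP => x; rewrite !inE; case: eqVneq => //= ->.
  by rewrite (negbTE sS) andbF.
have -> : (s |: S) :\: I = s |: (S :\: I).
  apply/finset.setP => x; rewrite !inE; case: eqVneq => //= ->.
  by rewrite sI.
rewrite cardsU1 !inE (negbTE sS) andbF add1n exprS mulN1r scaleNr addrC.
by congr (_ *: phi _ - _); rewrite finset.setUCA finset.setUA.
Qed.

Lemma cdiff_eq (R : pzRingType) (V : lmodType R) (T : finType) (S : {set T})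
    (phi psi : {set T} -> V) (A : {set T}) :
  (forall I : {set T}, I \subset S -> phi (I :|: A) = psi (I :|: A)) ->
  cdiff S phi A = cdiff S psi A.
Proof. by move=> e; apply: eq_bigr => I IS; rewrite e. Qed.

(** The terms of [I] and [s |: I] cancel. *)
Lemma cdiff_const0 (R : pzRingType) (V : lmodType R) (T : finType) (s : T)
    (S : {set T}) (phi : {set T} -> V) (A : {set T}) : s \in S ->
  (forall I, phi (s |: I) = phi I) -> cdiff S phi A = 0.
Proof.
move=> sS e; rewrite -(finset.setD1K sS) cdiffU1 ?setD11//; apply/eqP.
rewrite subr_eq0; apply/eqP/eq_bigr => I _.
by rewrite finset.setUCA e.
Qed.

Lemma cdiffD (R : pzRingType) (V : lmodType R) (T : finType) (S : {set T})
    (phi psi : {set T} -> V) (A : {set T}) :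
  cdiff S (fun I => phi I + psi I) A = cdiff S phi A + cdiff S psi A.
Proof. by rewrite -big_split /=; apply: eq_bigr => I _; rewrite scalerDr. Qed.

Lemma cdiff_sum (R : pzRingType) (V : lmodType R) (T J : finType) (S : {set T})
    (phi : J -> {set T} -> V) (A : {set T}) :
  cdiff S (fun I => \sum_j phi j I) A = \sum_j cdiff S (phi j) A.
Proof.
by rewrite exchange_big /=; apply: eq_bigr => I _; rewrite scaler_sumr.
Qed.

(** Discrete Leibniz rule. Each direction differentiates one of the factors;
    when it is the second one, the first factor is taken on the far face. *)
Lemma cdiffM (R : comPzRingType) (T : finType) (S : {set T})
    (phi psi : {set T} -> R^o) (A : {set T}) :
  cdiff S (fun I => phi I * psi I : R^o) A =
  \sum_(U : {set T} | U \subset S)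
     cdiff U phi (A :|: (S :\: U)) * cdiff (S :\: U) psi A.
Proof.
move: {2}#|S| (erefl #|S|) => c cS; elim: c S cS A => [|c IH] S cS A.
  have -> := cards0_eq cS.
  rewrite (big_pred1 finset.set0) => [|I]; last by rewrite finset.subset0.
  by rewrite finset.set0D finset.setU0 !cdiff0.
have [s sS] : exists s, s \in S by apply/set0Pn; rewrite -card_gt0 cS.
have cS' : #|S :\ s| = c by move: cS; rewrite (cardsD1 s) sS add1n => -[].
have sS' : s \notin S :\ s by rewrite setD11.
rewrite -(finset.setD1K sS); move: (S :\ s) sS' cS' => {cS sS} S' sS' cS'.
rewrite cdiffU1// !IH// sum_subsetU1// -sumrB; apply: eq_bigr => U US.
have sU : s \notin U by apply: contra sS' => /(fintype.subsetP US).
have sSU : s \notin S' :\: U by rewrite !inE (negbTE sS') andbF.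
have -> : (s |: S') :\: (s |: U) = S' :\: U.
  apply/finset.setP => x; rewrite !inE; case: eqVneq => //= ->.
  by rewrite (negbTE sS') andbF.
have -> : (s |: S') :\: U = s |: (S' :\: U).
  apply/finset.setP => x; rewrite !inE; case: eqVneq => //= ->.
  by rewrite sU.
rewrite !cdiffU1// (finset.setUCA A) -finset.setUA.
by ring.
Qed.

(** * Cubes of arbitrary points in the whole space *)

Lemma enorm_ge0 (R : realType) (p : nat) (v : 'rV[R]_p) : 0 <= enorm v.
Proof. exact: sqrtr_ge0. Qed.

Lemma sqr_enorm (R : realType) (p : nat) (v : 'rV[R]_p) :
  enorm v ^+ 2 = \sum_(i < p) v 0 i ^+ 2.
Proof. by rewrite sqr_sqrtr// sumr_ge0// => i _; rewrite sqr_ge0. Qed.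

Lemma normr_coord_le_enorm (R : realType) (p : nat) (v : 'rV[R]_p) (i : 'I_p) :
  `|v 0 i| <= enorm v.
Proof.
rewrite -(ger0_norm (enorm_ge0 v)) -ler_sqr ?nnegrE// !real_normK ?num_real//.
rewrite sqr_enorm (bigD1 i)//= lerDl sumr_ge0// => j _; exact: sqr_ge0.
Qed.

(** The square is convex in each coordinate, hence so is the squared norm. *)
Lemma enorm_convex_le (R : realType) (p : nat) (u v : 'rV[R]_p) (t c : R) :
  0 <= t <= 1 -> enorm u <= c -> enorm v <= c ->
  enorm ((1 - t) *: u + t *: v) <= c.
Proof.
move=> /andP[t0 t1] uc vc; have c0 := le_trans (enorm_ge0 u) uc.
rewrite -ler_sqr ?nnegrE ?enorm_ge0// sqr_enorm.
have {}uc : enorm u ^+ 2 <= c ^+ 2 by rewrite ler_sqr ?nnegrE ?enorm_ge0.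
have {}vc : enorm v ^+ 2 <= c ^+ 2 by rewrite ler_sqr ?nnegrE ?enorm_ge0.
apply: (@le_trans _ _ ((1 - t) * enorm u ^+ 2 + t * enorm v ^+ 2)); last by nra.
rewrite !sqr_enorm !mulr_sumr -big_split /=; apply: ler_sum => i _.
rewrite !mxE; set a := u 0 i; set b := v 0 i.
have h : 0 <= t * (1 - t) * (a - b) ^+ 2.
  by rewrite mulr_ge0 ?sqr_ge0// mulr_ge0// subr_ge0.
rewrite -subr_ge0.
by have -> : (1 - t) * a ^+ 2 + t * b ^+ 2 - ((1 - t) * a + t * b) ^+ 2 =
  t * (1 - t) * (a - b) ^+ 2 by ring.
Qed.

Lemma is_derive_bigsum (R : numFieldType) (V W : normedModType R) (J : Type)
    (r : seq J) (P : pred J) (F : J -> V -> W) (dF : J -> W) (x v : V) :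
  (forall j, P j -> is_derive x v (F j) (dF j)) ->
  is_derive x v (fun t => \sum_(j <- r | P j) F j t) (\sum_(j <- r | P j) dF j).
Proof.
move=> H; elim: r => [|j r IH].
  rewrite big_nil; under eq_fun do rewrite big_nil.
  exact: is_derive_cst.
rewrite big_cons; under eq_fun do rewrite big_cons.
by case: ifP => // Pj; exact: (is_deriveD (H j Pj) IH).
Qed.

Lemma derive_coord (R : realType) (n : nat) (g : 'rV[R]_n -> R)
    (y v : 'rV[R]_n) : differentiable g y ->
  'D_v g y = \sum_(a < n) 'D_(delta_mx 0 a) g y * v 0 a.
Proof.
move=> dg; rewrite deriveE// {1}[v]row_sum_delta linear_sum.
by apply: eq_bigr => a _; rewrite linearZ deriveE// mulrC.
Qed.

Lemma is_derive_line (R : realType) (n : nat) (g : 'rV[R]_n -> R)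
    (u v : 'rV[R]_n) (t : R) : differentiable g (u + t *: v) ->
  is_derive t (1 : R) (fun r => g (u + r *: v))
    (\sum_(a < n) 'D_(delta_mx 0 a) g (u + t *: v) * v 0 a).
Proof.
move=> dg; rewrite -derive_coord//.
have d : derivable g (u + t *: v) v := diff_derivable dg.
have E : (fun h : R => h^-1 *: (g (h *: v + (u + t *: v)) - g (u + t *: v))) =
  (fun h : R => h^-1 *: (((fun r => g (u + r *: v)) \o shift t) (h *: 1) -
      g (u + t *: v))).
  apply/funext => h /=; congr (_ *: (g _ - _)).
  have -> : h *: (1 : R) = h by exact: mulr1.
  by rewrite scalerDl addrCA.
apply: DeriveDef; first by rewrite /derivable /= -E; exact: d.
by rewrite /derive/= -E.
Qed.

(** Moving every vertex linearly to its partner in direction [s] turns the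
    difference in this direction into the increment over [0, 1] of a function
    of one variable. The interpolated vertices form a cube that is constant in
    direction [s], which is why they are written with [I :\ s] and [s |: I]. *)
Lemma cdiff_mvt (R : realType) (n : nat) (T : finType) (g : 'rV[R]_n -> R)
    (x : {set T} -> 'rV[R]_n) (s : T) (S A : {set T}) :
  (forall y, differentiable g y) -> s \notin S -> s \notin A ->
  exists2 t : R, 0 <= t <= 1 &
    cdiff (s |: S) (g \o x : _ -> R^o) A =
    cdiff S (fun I => \sum_(a < n) ('D_(delta_mx 0 a) g
        ((1 - t) *: x (I :\ s) + t *: x (s |: I)) *
        (x (s |: I) - x (I :\ s)) 0 a) : R^o) A.
Proof.
move=> dg sS sA.
pose y I := x (s |: I) - x (I :\ s).
pose th (r : R) := cdiff S (fun I => g (x (I :\ s) + r *: y I) : R^o) A.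
pose dth (r : R) := cdiff S (fun I => \sum_(a < n)
  ('D_(delta_mx 0 a) g (x (I :\ s) + r *: y I) * y I 0 a) : R^o) A.
have dthP (r : R) : is_derive r (1 : R) th (dth r).
  apply: is_derive_bigsum => I _.
  apply: is_deriveZ; exact: is_derive_line.
have th01 : cdiff (s |: S) (g \o x : _ -> R^o) A = th 1 - th 0.
  rewrite cdiffU1// /th; congr (_ - _); apply: eq_bigr => I IS; congr (_ *: g _).
    by rewrite scale1r addrC subrK finset.setUCA.
  rewrite scale0r addr0 [RHS]/= setD1_notin// inE negb_or sA andbT.
  by apply: contra sS => /(fintype.subsetP IS).
have [t t01 E] : exists2 c, c \in `[(0 : R), 1] & th 1 - th 0 = dth c * (1 - 0).
  apply: MVT_segment => // r0; apply: continuous_subspaceT => r.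
  have [d _] := dthP r.
  apply: differentiable_continuous; exact/derivable1_diffP.
exists t => //; rewrite th01 E subr0 mulr1; apply: cdiff_eq => I _.
apply: eq_bigr => a _; rewrite -/(y _).
suff -> : (1 - t) *: x ((I :|: A) :\ s) + t *: x (s |: (I :|: A)) =
          x ((I :|: A) :\ s) + t *: y (I :|: A) by [].
by rewrite scalerBr scalerBl scale1r addrA addrAC.
Qed.

(** The class [C^(l,alpha)] of the whole space with one bound for everything.
    The recursion on [l] follows the estimates below, which use up one
    derivative for each direction. *)
Fixpoint bounded_holder (R : realType) (n : nat) (alpha : R) (l : nat) (N : R)
    (g : 'rV[R]_n -> R) : Prop :=
  (forall x, `|g x| <= N) /\
  match l with
  | 0%N => forall x y, `|g x - g y| <= N * enorm (x - y) `^ alpha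
  | l'.+1 => (forall x, differentiable g x) /\
             forall a : 'I_n, bounded_holder alpha l' N ('D_(delta_mx 0 a) g)
  end.

(** A bound [p] replaces [Pset] because it passes to the interpolated cubes,
    whose own [Pset] is another number. *)
Definition cube_le (R : realType) (n : nat) (T : finType)
    (x : {set T} -> 'rV[R]_n) (p : {set T} -> R) (S : {set T}) : Prop :=
  forall B A : {set T}, B \subset S -> [disjoint A & B] ->
    enorm (cdiff B x A) <= p B.

(** With [c = #|S|.+1] every partition of [S] counts, with [c = #|S|] every
    partition but the one into singletons. *)
Definition partition_weight (R : realType) (T : finType) (p : {set T} -> R)
    (S : {set T}) (c : nat) : R :=
  \sum_(Q : {set {set T}} | finset.partition Q S && (#|Q| < c)%N)
    \prod_(B in Q) p B.

Lemma partition_weight_ge0 (R : realType) (T : finType) (p : {set T} -> R)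
    (S : {set T}) (c : nat) : (forall B, 0 <= p B) ->
  0 <= partition_weight p S c.
Proof. by move=> p0; rewrite sumr_ge0// => Q _; rewrite prodr_ge0. Qed.

Lemma partition_weight_set0 (R : realType) (T : finType) (p : {set T} -> R)
    (c : nat) : (forall B, 0 <= p B) -> 1 <= partition_weight p finset.set0 c.+1.
Proof.
move=> p0; rewrite /partition_weight (bigD1 finset.set0)/=; last first.
  by rewrite partition_set0 eqxx cards0.
by rewrite big_set0 lerDl sumr_ge0// => Q _; rewrite prodr_ge0.
Qed.

(** Adding [s |: (S :\: U)] to a partition of [U] gives a partition of [s |:
    S] with one more block. The factor is a crude bound for the number of
    partitions of [U]. *)
Lemma partition_weight_block (R : realType) (T : finType) (p : {set T} -> R)
    (s : T) (S U : {set T}) (c d : nat) : (forall B, 0 <= p B) ->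
  s \notin S -> U \subset S -> (c < d)%N ->
  partition_weight p U c * p (s |: (S :\: U)) <=
  #|{set {set T}}|%:R * partition_weight p (s |: S) d.
Proof.
move=> p0 sS US cd; rewrite mulr_suml.
apply: (@le_trans _ _ (\sum_(Q : {set {set T}}) partition_weight p (s |: S) d));
  last by rewrite sumr_const mulr_natl.
rewrite [leRHS](bigID (fun Q => finset.partition Q U && (#|Q| < c)%N))/=.
apply: ler_wpDr; first by rewrite sumr_ge0// => Q _; exact: partition_weight_ge0.
apply: ler_sum => Q /andP[QU Qc].
set B := s |: _.
have sB : s \in B by rewrite setU11.
have sU : s \notin U by apply: contra sS => /(fintype.subsetP US).
have BQ : B \notin Q.
  apply/negP => BQ; case/and3P: QU => /eqP cQ _ _.
  by move/negP: sU; apply; rewrite -cQ; apply/bigcupP; exists B.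
have BU : [disjoint B & U].
  rewrite -setI_eq0; apply/eqP/finset.setP => x; rewrite !inE.
  case: eqVneq => [->|_]/=; first by rewrite (negbTE sU).
  by case: (x \in U); rewrite ?andbF.
have QP : finset.partition (B |: Q) (s |: S).
  have -> : s |: S = B :|: U.
    apply/finset.setP => x; rewrite !inE -orbA; congr (_ || _).
    by have := fintype.subsetP US x; case: (x \in U) => [->|_]; rewrite ?orbF.
  by apply: partitionU1 => //; apply/set0Pn; exists s.
rewrite mulrC -[leLHS](big_setU1 _ BQ)/= /partition_weight (bigD1 (B |: Q))/=.
  by rewrite lerDl sumr_ge0// => Q' _; rewrite prodr_ge0.
by rewrite QP cardsU1 BQ add1n (leq_ltn_trans _ cd).
Qed.

Lemma coord_cdiff (R : realType) (n : nat) (T : finType) (S A : {set T})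
    (v : {set T} -> 'rV[R]_n) (a : 'I_n) :
  cdiff S v A 0 a = cdiff S (fun I => v I 0 a : R^o) A.
Proof. by rewrite /cdiff summxE; apply: eq_bigr => I _; rewrite mxE. Qed.

(** A difference of the interpolated cube is a convex combination of the same
    difference on two opposite faces. *)
Lemma cube_le_segment (R : realType) (n : nat) (T : finType)
    (x : {set T} -> 'rV[R]_n) (p : {set T} -> R) (s : T) (S : {set T}) (t : R) :
  0 <= t <= 1 -> s \notin S -> cube_le x p (s |: S) ->
  cube_le (fun I => (1 - t) *: x (I :\ s) + t *: x (s |: I)) p S.
Proof.
move=> t01 sS xp B A BS AB.
have sB : s \notin B by apply: contra sS => /(fintype.subsetP BS).
have BS' : B \subset s |: S by rewrite (fintype.subset_trans BS)// subsetU1.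
have -> : cdiff B (fun I => (1 - t) *: x (I :\ s) + t *: x (s |: I)) A =
    (1 - t) *: cdiff B x (A :\ s) + t *: cdiff B x (s |: A).
  rewrite cdiffD /cdiff !scaler_sumr; congr (_ + _); apply: eq_bigr => I IB.
    rewrite !scalerA mulrC; congr (_ *: x _).
    by rewrite finset.setDUl (@setD1_notin _ _ I)//;
      apply: contra sB => /(fintype.subsetP IB).
  by rewrite !scalerA mulrC finset.setUCA.
apply: enorm_convex_le => //; apply: xp => //.
  by apply: disjointWl AB; exact: subD1set.
rewrite -setI_eq0 finset.setIUl finset.setU_eq0 !setI_eq0 AB andbT.
by rewrite disjoints1.
Qed.

(** The origin of the partitions: after the mean value theorem, the directions
    of [S :\: U] that the Leibniz rule gives to the increment of the points
    form a block with [s], and the derivative keeps the directions [U]. *)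
Lemma cdiff_comp_step (R : realType) (n : nat) (T : finType)
    (g : 'rV[R]_n -> R) (x : {set T} -> 'rV[R]_n) (p : {set T} -> R) (s : T)
    (S A : {set T}) (W : R) :
  (forall y, differentiable g y) -> s \notin S -> [disjoint A & s |: S] ->
  cube_le x p (s |: S) ->
  (forall z (a : 'I_n) (U A' : {set T}), cube_le z p S -> U \subset S ->
     [disjoint A' & U] ->
     `|cdiff U ('D_(delta_mx 0 a) g \o z : _ -> R^o) A'| * p (s |: (S :\: U))
       <= W) ->
  `|cdiff (s |: S) (g \o x : _ -> R^o) A| <= (n * #|{set T}|)%:R * W.
Proof.
move=> dg sS dA xp HW.
have sA : s \notin A by rewrite (disjointFl dA)// setU11.
have [t t01 ->] := cdiff_mvt x dg sS sA.
set z := (fun I => (1 - t) *: x (I :\ s) + t *: x (s |: I)).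
have zp : cube_le z p S by exact: cube_le_segment.
have p0 (B : {set T}) : B \subset s |: S -> 0 <= p B.
  by move=> BS; apply: (le_trans (enorm_ge0 _)); apply: (xp B finset.set0) => //;
    rewrite -setI_eq0 finset.set0I.
have W0 (a : 'I_n) : 0 <= W.
  apply: le_trans (HW z a finset.set0 finset.set0 zp (finset.sub0set _) _).
    by rewrite mulr_ge0// p0// finset.setUS// finset.subsetDl.
  by rewrite -setI_eq0 finset.set0I.
rewrite cdiff_sum; apply: (le_trans (ler_norm_sum _ _ _)).
apply: (@le_trans _ _ (\sum_(a < n) #|{set T}|%:R * W)); last first.
  by rewrite sumr_const card_ord natrM -mulrA [leRHS]mulr_natl.
apply: ler_sum => a _; rewrite cdiffM; apply: (le_trans (ler_norm_sum _ _ _)).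
rewrite (_ : _ * W = \sum_(U : {set T}) W); last by rewrite sumr_const mulr_natl.
rewrite [leRHS](bigID (fun U : {set T} => U \subset S))/= ler_wpDr//.
  by rewrite sumr_ge0// => U _; exact: W0 a.
apply: ler_sum => U US; rewrite normrM.
have sSU : s \notin S :\: U by rewrite inE (negbTE sS) andbF.
have -> : cdiff (S :\: U) (fun I => (x (s |: I) - x (I :\ s)) 0 a : R^o) A =
          cdiff (s |: (S :\: U)) x A 0 a.
  rewrite cdiffU1// !mxE !coord_cdiff.
  have -> : - cdiff (S :\: U) (fun I => x I 0 a : R^o) A =
    - cdiff (S :\: U) (fun I => x (I :\ s) 0 a : R^o) A.
    congr (- _); apply: cdiff_eq => I IU; rewrite setD1_notin// inE negb_or sA.
    by rewrite andbT; apply: contra sSU => /(fintype.subsetP IU).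
  rewrite /cdiff -sumrB; apply: eq_bigr => I IU.
  by rewrite !mxE scalerBr finset.setUCA.
apply: le_trans (HW z a U (A :|: (S :\: U)) zp US _); last first.
  rewrite -setI_eq0; apply/eqP/finset.setP => y; rewrite !inE.
  have [yU|yU] := boolP (y \in U); rewrite ?andbF//= orbF andbT.
  by rewrite (disjointFl dA)// inE (fintype.subsetP US _ yU) orbT.
rewrite ler_wpM2l//; apply: (le_trans (normr_coord_le_enorm _ _)).
apply: xp; first by rewrite finset.setUS// finset.subsetDl.
by apply: disjointWr dA; rewrite finset.setUS// finset.subsetDl.
Qed.

Lemma bounded_holder_norm (R : realType) (n : nat) (alpha : R) (l : nat) (N : R)
    (g : 'rV[R]_n -> R) (x : 'rV[R]_n) : bounded_holder alpha l N g -> `|g x| <= N.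
Proof. by case: l => [|l] /= []. Qed.

(** With at most as many directions as derivatives, the peeling goes on until
    no direction is left, and only the bound of a derivative is used. *)
Lemma cdiff_comp_le (R : realType) (n : nat) (T : finType) (alpha : R)
    (l : nat) :
  exists2 C : R, 0 <= C &
    forall (N : R) (g : 'rV[R]_n -> R) (x : {set T} -> 'rV[R]_n)
      (p : {set T} -> R) (S A : {set T}), 0 <= N -> bounded_holder alpha l N g ->
      (forall B, 0 <= p B) -> (#|S| <= l)%N -> [disjoint A & S] ->
      cube_le x p S ->
      `|cdiff S (g \o x : _ -> R^o) A| <= C * N * partition_weight p S #|S|.+1.
Proof.
have base l' (N : R) (g : 'rV[R]_n -> R) (x : {set T} -> 'rV[R]_n)
    (p : {set T} -> R) (A : {set T}) : 0 <= N -> bounded_holder alpha l' N g ->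
    (forall B, 0 <= p B) ->
    `|cdiff finset.set0 (g \o x : _ -> R^o) A| <=
    N * partition_weight p finset.set0 1.
  move=> N0 gN p0; rewrite cdiff0/= (le_trans (bounded_holder_norm _ gN))//.
  by rewrite ler_peMr// partition_weight_set0.
elim: l => [|l [C C0 HC]].
  exists 1 => // N g x p S A N0 gN p0; rewrite leqn0 cards_eq0 => /eqP -> _ _.
  by rewrite mul1r cards0; exact: base gN p0.
set K : R := #|{set {set T}}|%:R; set M : R := (n * #|{set T}|)%:R.
exists (1 + M * (C * K)) => [|N g x p S A N0 gN p0 Sl AS xp].
  by rewrite addr_ge0// !mulr_ge0.
have [S0|/set0Pn[s sS]] := eqVneq S finset.set0.
  rewrite S0 cards0; apply: (le_trans (base _ _ _ _ _ _ N0 gN p0)).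
  rewrite -mulrA mulrDl mul1r lerDl !mulr_ge0//.
  exact: partition_weight_ge0.
have [_ [dg gN']] := gN.
have sS' : s \notin S :\ s by rewrite setD11.
have ES := finset.setD1K sS.
have cS : #|S| = #|S :\ s|.+1 by rewrite (cardsD1 s) sS.
rewrite -ES in AS xp; rewrite cS -[in cdiff S]ES.
set W := C * N * (K * partition_weight p (s |: (S :\ s)) #|S :\ s|.+2).
apply: (le_trans (cdiff_comp_step (W := W) dg sS' AS xp _)).
  move=> z a U A' zp US AU.
  have Ul : (#|U| <= #|S :\ s|)%N by exact: subset_leq_card.
  have zU : cube_le z p U.
    by move=> B A'' BU; apply: zp; exact: fintype.subset_trans BU US.
  have := HC N _ z p U A' N0 (gN' a) p0 _ AU zU => /(_ _)/le_trans h.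
  apply: le_trans (ler_wpM2r (p0 _) (h _ _ (lexx _))) _.
    by rewrite -ltnS -cS in Ul *; exact: leq_trans Ul (leq_trans _ Sl).
  rewrite -[leLHS]mulrA /W ler_wpM2l ?mulr_ge0//.
  exact: partition_weight_block.
rewrite -/M /W ES.
set w := partition_weight _ _ _; have w0 : 0 <= w by exact: partition_weight_ge0.
rewrite -subr_ge0.
have -> : (1 + M * (C * K)) * N * w - M * (C * N * (K * w)) = N * w by ring.
by rewrite mulr_ge0.
Qed.

(** With one direction more than derivatives, [e] is never the one that is
    peeled off. Either it joins a block of at least two elements, and then the
    remaining directions are few enough for [cdiff_comp_le]; or it is the last
    one left, and the Hoelder bound of the last derivative applies to it. *)
Lemma cdiff_comp_holder_le (R : realType) (n : nat) (T : finType) (alpha : R)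
    (l : nat) (e : T) : 0 < alpha ->
  exists2 C : R, 0 <= C &
    forall (N : R) (g : 'rV[R]_n -> R) (x : {set T} -> 'rV[R]_n)
      (p : {set T} -> R) (S A : {set T}), 0 <= N -> bounded_holder alpha l N g ->
      (forall B, 0 <= p B) -> e \in S -> #|S| = l.+1 -> [disjoint A & S] ->
      cube_le x p S ->
      `|cdiff S (g \o x : _ -> R^o) A| <= C * N *
        (p (finset.set1 e) `^ alpha * \prod_(i in S :\ e) p (finset.set1 i) +
         partition_weight p S #|S|).
Proof.
move=> a0; elim: l => [|l [C C0 HC]].
  exists 1 => // N g x p S A N0 [_ gN] p0 eS /eqP/cards1P[e' ES] AS xp.
  have ee' : e' = e by move: eS; rewrite ES inE => /eqP.
  rewrite {}ee' {e'} in ES; subst S.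
  have := xp _ A (fintype.subxx _) AS.
  rewrite -(finset.setU0 (finset.set1 e)) !cdiffU1 ?inE// !cdiff0/= => xe.
  rewrite mul1r; apply: (le_trans (gN _ _)); rewrite ler_wpM2l//.
  rewrite finset.setU0 in xe *.
  rewrite finset.setDv big_set0 mulr1 ler_wpDr//.
    exact: partition_weight_ge0.
  apply: ge0_ler_powR; rewrite ?nnegrE ?enorm_ge0 ?p0//; exact: ltW.
have [C1 C10 HC1] := cdiff_comp_le n T alpha l.
set K : R := #|{set {set T}}|%:R; set M : R := (n * #|{set T}|)%:R.
have K1 : 1 <= K.
  by rewrite /K ler1n; apply/card_gt0P; exists finset.set0.
exists (M * ((C + C1) * K)) => [|N g x p S A N0 gN p0 eS Sl AS xp].
  by rewrite !mulr_ge0// addr_ge0.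
have [s sSe] : exists s, s \in S :\ e.
  by apply/set0Pn; rewrite -card_gt0; move: Sl;
    rewrite (cardsD1 e) eS add1n => -[->].
have [se sS] : s != e /\ s \in S by move: sSe; rewrite !inE => /andP[].
have [_ [dg gN']] := gN.
have sS' : s \notin S :\ s by rewrite setD11.
have eS' : e \in S :\ s by rewrite !inE eq_sym se.
have ES := finset.setD1K sS.
have cS : #|S :\ s| = l.+1 by move: Sl; rewrite (cardsD1 s) sS add1n => -[].
rewrite -ES in AS xp; rewrite -[in cdiff S]ES.
set H := _ `^ alpha * _; have H0 : 0 <= H by rewrite mulr_ge0 ?powR_ge0 ?prodr_ge0.
set w := partition_weight p S #|S|.
have w0 : 0 <= w by exact: partition_weight_ge0.
set W := (C + C1) * N * (K * (H + w)).
rewrite (_ : M * _ * N * _ = M * W); last by rewrite /W; ring.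
apply: (cdiff_comp_step (W := W) dg sS' AS xp).
move=> z a U A' zp US AU.
have zU : cube_le z p U.
  by move=> B A'' BU; apply: zp; exact: fintype.subset_trans BU US.
(* If the derivative keeps all other directions, then [s] is a block by
   itself and the induction hypothesis applies. *)
have [EU|nU] := eqVneq U (S :\ s).
  rewrite {}EU {U} in US AU zU *.
  apply: le_trans (ler_wpM2r (p0 _)
    (HC N _ z p (S :\ s) A' N0 (gN' a) p0 eS' cS AU zU)) _.
  rewrite -[leLHS]mulrA.
  apply: (@le_trans _ _ (C * N * (K * (H + w)))); last first.
    by rewrite /W -!mulrA ler_wpM2r ?lerDl// !mulr_ge0// ?addr_ge0//
      (le_trans ler01).
  rewrite ler_wpM2l ?mulr_ge0// mulrDl mulrDr lerD//; last first.
    rewrite /w -[in leRHS]ES; apply: partition_weight_block => //.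
    by rewrite ES Sl cS.
  apply: (@le_trans _ _ H); last by rewrite ler_peMl.
  rewrite /H -[leLHS]mulrA ler_wpM2l ?powR_ge0//.
  rewrite finset.setDv finset.setU0 [leRHS](bigD1 s)//= mulrC ler_wpM2l//.
  rewrite le_eqVlt; apply/orP; left; apply/eqP/eq_bigl => i.
  by rewrite !inE; case: (i == e); case: (i == s); case: (i \in S).
have cU : (#|U| < l.+1)%N.
  rewrite -cS ltn_neqAle subset_leq_card// andbT.
  by apply: contra nU => cU; rewrite eqEcard US (eqP cU)/=.
have := HC1 N _ z p U A' N0 (gN' a) p0 cU AU zU.
move=> /(ler_wpM2r (p0 (s |: ((S :\ s) :\: U))))/le_trans; apply.
rewrite -[leLHS]mulrA.
apply: (@le_trans _ _ (C1 * N * (K * (H + w)))); last first.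
  by rewrite /W -!mulrA ler_wpM2r ?lerDr// !mulr_ge0// ?addr_ge0// (le_trans ler01).
rewrite ler_wpM2l ?mulr_ge0//.
apply: (@le_trans _ _ (K * w)); last by rewrite ler_wpM2l ?lerDr// (le_trans ler01).
rewrite /w -[in leRHS]ES; apply: partition_weight_block => //.
by rewrite ES Sl.
Qed.

Lemma cube_le_Pset (R : realType) (n m : nat) (x : {set 'I_m} -> 'rV[R]_n) :
  cube_le x (Pset x) [set: 'I_m]%SET.
Proof.
move=> B A _ AB.
have AB' : A \subset ~: B by rewrite -finset.disjoints_subset.
rewrite /Pset (bigD1 A)//= /Pcube lerDl sumr_ge0// => A' _.
exact: enorm_ge0.
Qed.

Lemma Pset_ge0 (R : realType) (n m : nat) (x : {set 'I_m} -> 'rV[R]_n)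
  (B : {set 'I_m}) : 0 <= Pset x B.
Proof. by rewrite sumr_ge0// => A _; exact: enorm_ge0. Qed.

Lemma partition_weight_Pset (R : realType) (n k : nat)
    (x : {set 'I_k.+1} -> 'rV[R]_n) :
  partition_weight (Pset x) [set: 'I_k.+1]%SET k.+1 =
  \sum_(1 <= j < k.+1) Ppart x j.
Proof.
rewrite /Ppart; under [RHS]eq_bigr do rewrite big_mkcondr/=.
rewrite exchange_big/= /partition_weight big_mkcondr/=; apply: eq_bigr => Q QT.
have Q0 : (0 < #|Q|)%N.
  rewrite card_gt0; apply/eqP => Q0; move: QT; rewrite Q0 => /cover_partition.
  rewrite /finset.cover big_set0 => /finset.setP/(_ ord0); by rewrite !inE.
case: ifPn => Qk.
  rewrite (bigD1_seq #|Q|) ?iota_uniq ?mem_index_iota ?Q0//= eqxx [X in _ +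
    X]big1 ?addr0//.
  by move=> j; rewrite eq_sym => /negbTE ->.
rewrite big_nat [RHS]big1// => j /andP[_ jk].
by rewrite gtn_eqF// (leq_trans jk)// leqNgt.
Qed.

(** The direction with the exponent alpha in [Ppow] is the last one. *)
Lemma cube_diff_le_Pmod (R : realType) (n k : nat) (alpha : R) : 0 < alpha ->
  exists2 C : R, 0 <= C &
    forall (N : R) (F : 'rV[R]_n -> R) (x : {set 'I_k.+1} -> 'rV[R]_n),
      0 <= N -> bounded_holder alpha k N F ->
      `|\sum_(I : {set 'I_k.+1}) (-1) ^+ #|~: I| * F (x I)| <=
      C * N * Pmod (k%:R + alpha) x.
Proof.
move=> a0.
have [C C0 HC] := cdiff_comp_holder_le n k (ord_max : 'I_k.+1) a0.
exists C => // N F x N0 FN.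
have -> : \sum_(I : {set 'I_k.+1}) (-1) ^+ #|~: I| * F (x I) =
    cdiff [set: 'I_k.+1]%SET (F \o x : _ -> R^o) finset.set0.
  rewrite /cdiff; apply: eq_big => [I|I _]; first by rewrite finset.subsetT.
  by rewrite finset.setTD finset.setU0.
apply: le_trans (HC N F x (Pset x) _ finset.set0 N0 FN (@Pset_ge0 _ _ _ x)
  (finset.in_setT _) _ _ (@cube_le_Pset _ _ _ x)) _; rewrite ?cardsT ?card_ord//.
  by rewrite -setI_eq0 finset.set0I.
rewrite partition_weight_Pset /Pmod /Ppow addrAC subrr add0r.
rewrite le_eqVlt; apply/orP; left; apply/eqP; congr (_ * (_ * _ + _)).
apply: eq_bigl => i; rewrite !inE andbT -val_eqE/=.
by rewrite ltn_neqAle -ltnS ltn_ord andbT.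
Qed.

(** * Extracting pointwise bounds from the norms *)

Lemma supE_ub (R : realType) (U : Type) (A : set U) (h : U -> \bar R) (x : U) :
  A x -> (h x <= supE A h)%E.
Proof. by move=> Ax; apply: ereal_sup_ubound; right; exists x. Qed.

Lemma supE_ge0 (R : realType) (U : Type) (A : set U) (h : U -> \bar R) :
  (0 <= supE A h)%E.
Proof. by apply: ereal_sup_ubound; left. Qed.

Lemma supE_le (R : realType) (U : Type) (A : set U) (h : U -> \bar R)
    (c : \bar R) : (0 <= c)%E -> (forall x, A x -> (h x <= c)%E) ->
  (supE A h <= c)%E.
Proof.
by move=> c0 hc; apply: ge_ereal_sup => _ [->//|[x Ax <-]]; exact: hc.
Qed.

Lemma enorm0 (R : realType) (p : nat) : enorm (0 : 'rV[R]_p) = 0.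
Proof. by rewrite /enorm big1 ?sqrtr0// => i _; rewrite mxE expr0n. Qed.

Lemma enorm_eq0 (R : realType) (p : nat) (v : 'rV[R]_p) :
  (enorm v == 0) = (v == 0).
Proof.
apply/eqP/eqP => [v0|->]; last exact: enorm0.
apply/rowP => i; rewrite mxE; apply/eqP.
by rewrite -normr_le0 -v0; exact: normr_coord_le_enorm.
Qed.

Lemma nabla_coord (R : realType) (n : nat) (f : 'rV[R]_n -> R)
    (w : seq 'I_n) (x : 'rV[R]_n) :
  exists t, forall y, nabla (size w) f y 0 t = pderiv w f y.
Proof.
exists (enum_rank (in_tuple w)) => y.
by rewrite mxE enum_rankK.
Qed.

Lemma Cb_bounded_holder (R : realType) (n k : nat) (alpha N : R)
    (F : 'rV[R]_n -> R) :
  carrier (Cb k alpha [set: 'rV[R]_n]%classic) F ->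
  (fnorm (Cb k alpha [set: 'rV[R]_n]%classic) F <= N%:E)%E ->
  bounded_holder alpha k N F.
Proof.
move=> [[[dF _] _ _] _] /= FN.
have sup_le : (sup_abs setT F <= N%:E)%E.
  apply: le_trans FN; rewrite leeDl// adde_ge0 ?supE_ge0//.
  by apply: sume_ge0 => j _; exact: supE_ge0.
have hol_le : (holder alpha setT (nabla k F) <= N%:E)%E.
  apply: le_trans FN; rewrite /Cma_seminorm addeA leeDr// adde_ge0 ?supE_ge0//.
  by apply: sume_ge0 => j _; exact: supE_ge0.
have nab_le j : (0 < j <= k)%N -> (sup_norm setT (nabla j F) <= N%:E)%E.
  move=> jk; apply: le_trans FN; rewrite /Cma_seminorm.
  apply: (@le_trans _ _ (\sum_(1 <= i < k.+1) sup_norm setT (nabla i F))%E).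
    rewrite (bigD1_seq j) ?iota_uniq ?mem_index_iota//=; apply: leeDl.
    by apply: sume_ge0 => i _; exact: supE_ge0.
  rewrite addeCA leeDl// adde_ge0 ?supE_ge0//.
have bnd (w : seq 'I_n) x : (size w <= k)%N -> `|pderiv w F x| <= N.
  case: w => [_|a w wk].
    by rewrite -lee_fin; apply: le_trans sup_le;
      exact: (@supE_ub _ _ setT (fun x => `|F x|%:E)).
  have [t Ht] := nabla_coord F (a :: w) x.
  rewrite -Ht (le_trans (normr_coord_le_enorm _ _))// -lee_fin.
  apply: le_trans (nab_le (size (a :: w)) _) => //.
  exact: (@supE_ub _ _ setT (fun x => (enorm (nabla (size (a :: w)) F x))%:E)).
suff H l (w : seq 'I_n) : (size w + l = k)%N ->
  bounded_holder alpha l N (pderiv w F).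
  exact: (H k [::]).
elim: l w => [|l IH] w wk; (split; first by move=> x; apply: bnd;
  rewrite -wk leq_addr).
  rewrite addn0 in wk => x y; have [t Ht] := nabla_coord F w x.
  have [->|xy] := eqVneq x y.
    rewrite !subrr normr0 mulr_ge0 ?powR_ge0//.
    by apply: le_trans (bnd w x _); rewrite ?wk.
  have xy0 : 0 < enorm (x - y) by rewrite lt_neqAle eq_sym enorm_eq0 subr_eq0
    xy enorm_ge0.
  rewrite -ler_pdivrMr ?powR_gt0// -lee_fin; apply: le_trans hol_le.
  apply: le_trans (@supE_ub _ _ (fun z : 'rV[R]_n * 'rV[R]_n => [/\ setT z.1,
    setT z.2 & z.1 <> z.2])
    (fun z => (enorm (nabla k F z.1 - nabla k F z.2) / (enorm (z.1 - z.2) `^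
      alpha))%:E) (x, y) _).
    rewrite lee_fin ler_pM2r ?invr_gt0 ?powR_gt0// -wk -!Ht.
    apply: le_trans (normr_coord_le_enorm _ t); by rewrite !mxE.
  by split=> //=; apply/eqP.
split; last by move=> a; apply: (IH (a :: w)); rewrite -wk addSnnS.
move=> x; have [t Ht] := nabla_coord F w x.
have -> : pderiv w F = (fun M : 'rV_ _ => M 0 t) \o nabla (size w) F.
  by apply/funext => y /=; rewrite Ht.
apply: differentiable_comp; last exact: differentiable_coord.
by apply: dF => //; rewrite -wk -addSnnS leq_addr.
Qed.

Lemma sup_abs_fin (R : realType) (n : nat) (Omega : set 'rV[R]_n)
    (f : 'rV[R]_n -> R) : bounded_extension Omega (nabla 0 f) ->
  (sup_abs Omega f < +oo)%E.
Proof.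
move=> [g [gE _ gfin]]; apply: le_lt_trans gfin.
apply: supE_le => [|x Ox]; first exact: supE_ge0.
have [t Ht] := nabla_coord f [::] x.
apply: le_trans (@supE_ub _ _ (closure Omega) (fun x => (enorm (g x))%:E) x _).
  by rewrite lee_fin gE//; apply: le_trans (normr_coord_le_enorm _ t); rewrite Ht.
exact: subset_closure.
Qed.

Lemma fnorm_Cb_fin (R : realType) (n k : nat) (alpha : R)
    (Omega : set 'rV[R]_n) (f : 'rV[R]_n -> R) :
  carrier (Cb k alpha Omega) f -> fnorm (Cb k alpha Omega) f \is a fin_num.
Proof.
move=> [[_ nf hf] ext] /=.
have ge0 : (0 <= Cma_seminorm k alpha Omega f)%E.
  apply: adde_ge0; last exact: supE_ge0.
  by apply: sume_ge0 => j _; exact: supE_ge0.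
rewrite ge0_fin_numE; last by apply: adde_ge0 => //; exact: supE_ge0.
apply: lte_add_pinfty; first by apply: sup_abs_fin; exact: ext.
apply: lte_add_pinfty; last exact: hf.
rewrite big_nat_cond.
by apply: lte_sum_pinfty => j /andP[jk _]; apply: nf.
Qed.

Lemma Pmod_ge0 (R : realType) (n k : nat) (s : R)
    (x : {set 'I_k.+1} -> 'rV[R]_n) : 0 <= Pmod s x.
Proof.
rewrite addr_ge0//; last first.
  rewrite sumr_ge0// => j _; rewrite sumr_ge0// => Q _.
  by rewrite prodr_ge0// => B _; exact: Pset_ge0.
by rewrite mulr_ge0 ?powR_ge0// prodr_ge0// => j _; exact: Pset_ge0.
Qed.

(** Multiplying by the number of vertices only enlarges the right-hand side,
    so a constant is a gradient as soon as it bounds the difference once. *)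
Lemma Dgrad_cst (R : realType) (n k : nat) (s : R) (Omega : set 'rV[R]_n)
    (f : 'rV[R]_n -> R) (c : R) : 0 <= c ->
  (forall x : {set 'I_k.+1} -> 'rV[R]_n, (forall I, Omega (x I)) ->
    `|\sum_(I : {set 'I_k.+1}) (-1) ^+ #|~: I| * f (x I)| <= c * Pmod s x) ->
  Dgrad k s Omega f (fun=> c%:E).
Proof.
move=> c0 H; split=> [y _|x Ox]; first by rewrite lee_fin.
rewrite sumEFin -EFinM lee_fin (le_trans (H x Ox))// mulrC.
by rewrite ler_wpM2l ?Pmod_ge0// (bigD1 finset.set0)//= lerDl sumr_ge0.
Qed.

(** The estimate on cubes needs the segments between the points, so it is
    applied to the extension; its outcome is a constant gradient. *)
Lemma Cb_embeds_MLinf (R : realType) (n k : nat) (alpha : R)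
    (Omega : set 'rV[R]_n) : 0 < alpha ->
  (exists E, bounded_extension_operator k alpha Omega E) ->
  embeds (Cb k alpha Omega) (MLinf k (k%:R + alpha) Omega).
Proof.
move=> a0 [E [_ [CE CE0 HE]]].
have [K K0 HK] := cube_diff_le_Pmod n k a0.
have key f : carrier (Cb k alpha Omega) f ->
    let c := K * (CE * fine (fnorm (Cb k alpha Omega) f)) in
    0 <= c /\ Dgrad k (k%:R + alpha) Omega f (fun=> c%:E).
  move=> fC c; have [EfC Ef Efn] := HE f fC.
  set N := CE * fine (fnorm (Cb k alpha Omega) f) in c *.
  have EfN : (fnorm (Cb k alpha setT) (E f) <= N%:E)%E.
    by rewrite EFinM fineK// fnorm_Cb_fin.
  have Es := Cb_bounded_holder EfC EfN.
  have N0 : 0 <= N by exact: le_trans (normr_ge0 _) (bounded_holder_norm 0 Es).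
  have c0 : 0 <= c by rewrite mulr_ge0.
  split=> //; apply: Dgrad_cst => // x Ox.
  under eq_bigr do rewrite -Ef//.
  exact: HK.
have sup_cst (c : R) : 0 <= c -> (supE Omega (fun=> c%:E) <= c%:E)%E.
  by move=> c0; apply: supE_le => //; rewrite lee_fin.
split=> [f fC|].
  have [c0 fG] := key f fC.
  split; first by apply: sup_abs_fin; case: fC => _; apply.
  by exists (fun=> (K * (CE * fine (fnorm (Cb k alpha Omega) f)))%:E);
    split=> //; rewrite (le_lt_trans (sup_cst _ c0))// ltry.
exists (1 + K * CE) => f fC; have [c0 fG] := key f fC.
rewrite EFinD ge0_muleDl ?lee_fin ?mulr_ge0// ?(ltW CE0)// mul1e.
apply: leeD.
  rewrite /= leeDl//; apply: adde_ge0; last exact: supE_ge0.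
  by apply: sume_ge0 => j _; exact: supE_ge0.
rewrite -[in leRHS](fineK (fnorm_Cb_fin fC)) -EFinM -mulrA.
apply: le_trans (sup_cst _ c0).
by apply: ereal_inf_lbound;
  exists (fun=> (K * (CE * fine (fnorm (Cb k alpha Omega) f)))%:E).
Qed.

(** * Collapsed parallelepipeds *)

Fixpoint iterdiff (R : realType) (n : nat) (hs : seq 'rV[R]_n)
    (g : 'rV[R]_n -> R) (x : 'rV[R]_n) : R :=
  if hs is h :: hs' then iterdiff hs' g (x + h) - iterdiff hs' g x else g x.

Fixpoint vertices_in (R : realType) (n : nat) (Omega : set 'rV[R]_n)
    (hs : seq 'rV[R]_n) (x : 'rV[R]_n) : Prop :=
  if hs is h :: hs' then
    vertices_in Omega hs' (x + h) /\ vertices_in Omega hs' x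
  else Omega x.

Lemma vertices_in_sum (R : realType) (n : nat) (Omega : set 'rV[R]_n)
    (hs : seq 'rV[R]_n) (x : 'rV[R]_n) (b : nat -> bool) :
  vertices_in Omega hs x ->
  Omega (x + \sum_(i < size hs) if b i then hs`_i else 0).
Proof.
elim: hs x b => [|h hs IH] x b /=; first by rewrite big_ord0 addr0.
move=> [xh xO]; rewrite big_ord_recl /= addrA.
have H y := IH y (fun i => b i.+1).
by case: (b 0%N); [exact: H | rewrite addr0; exact: H].
Qed.

(** Elements from [L.-1] on share the last block, so that [L] steps use all
    [k.+1] directions. *)
Definition block (k L j : nat) : {set 'I_k.+1} :=
  [set i : 'I_k.+1 | minn i L.-1 == j]%SET.

(** A step is present at [I] only if its whole block is. A difference of order
    [k.+1] over these points is then one of order [size hs], and for [size hs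
    = k.+1] this is the usual parallelepiped. *)
Definition collapse (R : realType) (n k : nat) (x : 'rV[R]_n)
    (hs : seq 'rV[R]_n) (I : {set 'I_k.+1}) : 'rV[R]_n :=
  x + \sum_(j < k.+1 | (j < size hs)%N)
        (if block k (size hs) j \subset I then hs`_j else 0).

Lemma vertices_in_collapse (R : realType) (n k : nat) (Omega : set 'rV[R]_n)
    (hs : seq 'rV[R]_n) (x : 'rV[R]_n) (I : {set 'I_k.+1}) :
  (size hs <= k.+1)%N -> vertices_in Omega hs x -> Omega (collapse x hs I).
Proof.
move=> hk /(vertices_in_sum (fun j => block k (size hs) j \subset I)).
by rewrite (big_ord_widen _
  (fun j => if block k (size hs) j \subset I then hs`_j else 0) hk).
Qed.

(** Only the term [I = S] can put all of [B] into [I :|: A]. *)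
Lemma cdiff_indic (R : pzRingType) (V : lmodType R) (T : finType)
    (S B A : {set T}) (v : V) : S \subset B -> [disjoint A & S] ->
  cdiff S (fun I => if B \subset I then v else 0) A =
  if B \subset S :|: A then v else 0.
Proof.
move=> SB AS; rewrite /cdiff (bigD1 S)//= big1 => [|I /andP[IS nIS]].
  by rewrite finset.setDv cards0 expr0 scale1r addr0.
have /fintype.subsetPn[s sS sI] : ~~ (S \subset I).
  by apply: contra nIS => SI; rewrite finset.eqEsubset IS.
rewrite ifN ?scaler0//; apply/fintype.subsetPn; exists s.
  exact: (fintype.subsetP SB).
by rewrite inE negb_or sI (disjointFl AS).
Qed.

Lemma block_lt (k L j : nat) (I : {set 'I_k.+1}) (jk : (j < k.+1)%N) :
  (j < L.-1)%N -> (block k L j \subset I) = (Ordinal jk \in I).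
Proof.
move=> jL; apply/fintype.subsetP/idP => [H|jI i].
  by apply: H; rewrite inE (minn_idPl (ltnW jL)).
rewrite inE => /eqP ij; suff -> : i = Ordinal jk by [].
apply: val_inj => /=; move: ij; rewrite /minn; case: ltnP => // _ Lj.
by rewrite Lj ltnn in jL.
Qed.

Lemma block_last (k L : nat) :
  block k L L.-1 = [set i : 'I_k.+1 | (L.-1 <= i)%N]%SET.
Proof.
apply/finset.setP => i; rewrite !inE.
by apply/eqP/idP => [/minn_idPr|/minn_idPr].
Qed.

(** The first directions are steps of their own and are peeled off one by one.
    The last block contributes a single difference, as the tuple changes only
    once it is complete. *)
Lemma cdiff_collapse (R : realType) (n k : nat) (f : 'rV[R]_n -> R)
    (hs : seq 'rV[R]_n) (x : 'rV[R]_n) :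
  (0 < size hs <= k.+1)%N ->
  cdiff [set: 'I_k.+1]%SET (f \o collapse x hs : _ -> R^o) finset.set0 =
  iterdiff hs f x.
Proof.
set L := size hs => /andP[L0 Lk]; have LE : L.-1.+1 = L by rewrite prednK.
(* Induction on the number [d] of directions still to be peeled off before
   the last block; [A] tells which of the first [j] steps have been taken. *)
suff H d j (A : {set 'I_k.+1}) : (j + d)%N = L.-1 ->
    A \subset [set i : 'I_k.+1 | (i < j)%N]%SET ->
    cdiff [set i : 'I_k.+1 | (j <= i)%N]%SET (f \o collapse x hs : _ -> R^o) A =
    iterdiff (drop j hs) f (collapse x hs A).
  have := H L.-1 0%N finset.set0 erefl (finset.sub0set _).
  rewrite drop0 {2}/collapse big1 ?addr0 => [<-|i iL].
    by congr cdiff; apply/finset.setP => i; rewrite !inE.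
  rewrite ifN// finset.subset0; apply/set0Pn; exists i.
  by rewrite inE; apply/eqP/minn_idPl; rewrite -ltnS LE.
elim: d j A => [|d IH] j A jd Aj.
  rewrite addn0 in jd; subst j.
  rewrite (drop_nth 0) ?LE// drop_oversize ?LE//=.
  set X := collapse x hs; set B := finset _; set h := hs`_ _.
  have BE : B = block k L L.-1 by rewrite block_last.
  have AB : [disjoint A & B].
    rewrite -setI_eq0; apply/eqP/finset.setP => i; rewrite !inE.
    have := fintype.subsetP Aj i; rewrite inE; case: (i \in A) => //= /(_ isT).
    by rewrite ltnNge => /negbTE.
  have Lk' : (L.-1 < k.+1)%N by rewrite LE.
  have lB : Ordinal Lk' \in B by rewrite inE /=.
  have XI (I : {set 'I_k.+1}) : I \subset B ->
    X (I :|: A) = X A + if B \subset I :|: A then h else 0.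
    move=> IB; rewrite /X /collapse -addrA; congr (_ + _).
    rewrite (bigD1 (Ordinal Lk'))/= ?LE// [in RHS](bigD1 (Ordinal Lk'))/= ?LE//.
    rewrite -/L -BE (_ : B \subset A = false); last first.
      apply/negbTE/fintype.subsetPn; exists (Ordinal Lk') => //.
      by rewrite (disjointFl AB).
    rewrite add0r addrC; congr (_ + _); apply: eq_bigr => -[i ik] /= /andP[iL].
    rewrite -val_eqE/= => nil.
    have il : (i < L.-1)%N by rewrite ltn_neqAle nil -ltnS LE.
    rewrite !(block_lt _ ik)// inE orbC; case: (_ \in A) => //=.
    rewrite ifN//; apply: contraTN il => /(fintype.subsetP IB).
    by rewrite inE /= -leqNgt.
  rewrite (cdiff_eq (psi := fun I => f (X A) +
      (if B \subset I then f (X A + h) - f (X A) else 0))); last first.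
    move=> I IB; rewrite /= XI//; case: ifP => _; last by rewrite !addr0.
    by rewrite [RHS]addrC subrK.
  rewrite cdiffD (@cdiff_const0 _ _ _ (Ordinal Lk') B) ?add0r// cdiff_indic//.
  by rewrite finset.subsetUl.
have jL : (j < L.-1)%N by rewrite -jd addnS ltnS leq_addr.
have jk : (j < k.+1)%N by apply: leq_trans Lk; rewrite -LE ltnS ltnW.
have -> : [set i : 'I_k.+1 | (j <= i)%N]%SET =
    Ordinal jk |: [set i : 'I_k.+1 | (j.+1 <= i)%N]%SET.
  by apply/finset.setP => i; rewrite !inE leq_eqVlt -val_eqE/= eq_sym.
have A1 : A \subset [set i : 'I_k.+1 | (i < j.+1)%N]%SET.
  by apply: (fintype.subset_trans Aj); apply/fintype.subsetP => i;
    rewrite !inE => /ltnW.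
have A2 : Ordinal jk |: A \subset [set i : 'I_k.+1 | (i < j.+1)%N]%SET.
  by rewrite finset.subUset finset.sub1set inE ltnSn A1.
rewrite cdiffU1 ?inE ?ltnn// !IH ?addSnnS//.
have jLs : (j < size hs)%N by rewrite -/L -LE ltnS ltnW.
rewrite (drop_nth 0 jLs)/=.
congr (iterdiff _ _ _ - _).
rewrite /collapse -addrA; congr (_ + _).
have jA : Ordinal jk \notin A.
  by apply/negP => /(fintype.subsetP Aj); rewrite inE ltnn.
rewrite (bigD1 (Ordinal jk))//= [in RHS](bigD1 (Ordinal jk))//=.
rewrite !(block_lt _ jk)// setU11 (negbTE jA) add0r addrC; congr (_ + _).
apply: eq_bigr => -[i ik] /= /andP[iL nij]; rewrite -/L in iL *.
have := iL; rewrite -LE ltnS leq_eqVlt => /orP[/eqP il|il].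
  have notin (I : {set 'I_k.+1}) : Ordinal ik \notin I ->
    block k L i \subset I = false.
    move=> iI; apply/negbTE/fintype.subsetPn; exists (Ordinal ik) => //.
    have -> : block k L i = block k L L.-1 by congr block.
    by rewrite block_last inE /= -il.
  have iA : Ordinal ik \notin A.
    apply/negP => /(fintype.subsetP Aj); rewrite inE/= il => /ltn_trans/(_ jL).
    by rewrite ltnn.
  by rewrite !notin// !inE negb_or nij.
by rewrite !(block_lt _ ik)// inE inE (negbTE nij).
Qed.

(** The difference of a collapsed parallelepiped over [S] keeps only the steps
    whose block contains [S]; the blocks are disjoint, so at most one does. *)
Lemma Pcube_collapse (R : realType) (n k : nat) (x : 'rV[R]_n)
    (hs : seq 'rV[R]_n) (S A : {set 'I_k.+1}) (s : 'I_k.+1) :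
  s \in S -> A \subset ~: S -> (0 < size hs)%N ->
  Pcube (collapse x hs) S A <=
  if S \subset block k (size hs) (minn s (size hs).-1)
  then enorm hs`_(minn s (size hs).-1) else 0.
Proof.
set L := size hs => sS AS L0; set l := minn s L.-1.
have AS' : [disjoint A & S] by rewrite finset.disjoints_subset.
have lk : (l < k.+1)%N by rewrite (leq_ltn_trans (geq_minl _ _)).
have lL : (l < L)%N by rewrite -(prednK L0) ltnS geq_minr.
have -> : Pcube (collapse x hs) S A = enorm (cdiff S (collapse x hs) A) by [].
have -> : cdiff S (collapse x hs) A = \sum_(j < k.+1 | (j < L)%N)
    cdiff S (fun I => if block k L j \subset I then hs`_j else 0) A.
  rewrite cdiffD (@cdiff_const0 _ _ _ s S (fun=> x))// add0r exchange_big/=.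
  by apply: eq_bigr => I _; rewrite scaler_sumr.
have z0 (j : 'I_k.+1) : ~~ (S \subset block k L j) ->
    cdiff S (fun I => if block k L j \subset I then hs`_j else 0) A = 0.
  move=> /fintype.subsetPn[i iS ij].
  apply: (@cdiff_const0 _ _ _ i _ _ _ iS) => I.
  by rewrite subset_setU1_notin.
have sl (j : 'I_k.+1) : (j < L)%N -> S \subset block k L j -> j = Ordinal lk.
  move=> jL /fintype.subsetP/(_ s sS); rewrite inE => /eqP js.
  by apply: val_inj; rewrite /= -js.
have [Sl|Sl] := ifPn.
  rewrite (bigD1 (Ordinal lk))//= [X in _ + X]big1 ?addr0; last first.
    move=> j /andP[jL nj]; apply: z0; apply: contra nj => Sj.
    by apply/eqP/sl.
  rewrite cdiff_indic//; case: ifP => // _.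
  by rewrite enorm0 enorm_ge0.
rewrite big1 ?enorm0// => j jL.
by apply: z0; apply: contra Sl => Sj; move: (Sj); rewrite (sl j).
Qed.

Lemma Pset_collapse (R : realType) (n k : nat) (x : 'rV[R]_n)
    (hs : seq 'rV[R]_n) (S : {set 'I_k.+1}) (s : 'I_k.+1) :
  s \in S -> (0 < size hs)%N ->
  Pset (collapse x hs) S <=
  if S \subset block k (size hs) (minn s (size hs).-1)
  then #|{set 'I_k.+1}|%:R * enorm hs`_(minn s (size hs).-1) else 0.
Proof.
move=> sS L0; set b := S \subset _; set h := hs`_ _.
apply: (@le_trans _ _ (\sum_(A : {set 'I_k.+1} | A \subset ~: S)
    if b then enorm h else 0)).
  by apply: ler_sum => A AS; exact: Pcube_collapse.
case: b; last by rewrite big1.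
rewrite mulr_natl -sumr_const.
rewrite [leRHS](bigID (fun A : {set 'I_k.+1} => A \subset ~: S))/= lerDl.
by rewrite sumr_ge0// => A _; exact: enorm_ge0.
Qed.

(** A partition that does not refine the collapsed one contributes zero.
    Otherwise every step is the length attached to at least one of the blocks,
    and the remaining factors are at most one. *)
Lemma prod_Pset_collapse (R : realType) (n k : nat) (x : 'rV[R]_n)
    (hs : seq 'rV[R]_n) (Q : {set {set 'I_k.+1}}) :
  (0 < size hs <= k.+1)%N -> (forall h, h \in hs -> enorm h <= 1) ->
  finset.partition Q [set: 'I_k.+1]%SET ->
  \prod_(S in Q) Pset (collapse x hs) S <=
  #|{set 'I_k.+1}|%:R ^+ #|{set 'I_k.+1}| *
  \prod_(j < k.+1 | (j < size hs)%N) enorm hs`_j.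
Proof.
set L := size hs; set c : R := #|_|%:R => /andP[L0 Lk] h1 QT.
have [/eqP covQ _ Q0] := and3P QT.
have c1 : 1 <= c by rewrite /c ler1n; apply/card_gt0P; exists finset.set0.
have rhs0 : 0 <= c ^+ #|{set 'I_k.+1}| * \prod_(j < k.+1 | (j < L)%N) enorm hs`_j.
  by rewrite mulr_ge0 ?exprn_ge0 ?prodr_ge0// => *; exact: enorm_ge0.
have mem_nonempty S : S \in Q -> exists s, s \in S.
  by move=> SQ; apply/set0Pn; apply: contraNneq Q0 => <-.
have [/existsP[S /andP[SQ nS]]|all_in] :=
  boolP [exists S in Q, [forall s in S, ~~ (S \subset block k L (minn s L.-1))]].
  rewrite (bigD1 S)//=; have [s sS] := mem_nonempty S SQ.
  suff -> : Pset (collapse x hs) S = 0 by rewrite mul0r.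
  apply/eqP; rewrite eq_le Pset_ge0 andbT.
  have := @Pset_collapse _ n _ x hs S s sS L0.
  by move/forall_inP: nS => /(_ s sS) /negbTE ->.
pose beta (S : {set 'I_k.+1}) : 'I_k.+1 :=
  odflt ord0 [pick j : 'I_k.+1 | (j < L)%N && (S \subset block k L j)].
have betaP S : S \in Q -> (beta S < L)%N /\ S \subset block k L (beta S).
  move=> SQ; rewrite /beta; case: pickP => [j /andP[]//|none].
  case/negP: all_in; apply/existsP; exists S; rewrite SQ.
  apply/forall_inP => s sS.
  have lk : (minn s L.-1 < k.+1)%N by rewrite (leq_ltn_trans (geq_minl _ _)).
  have lL : (minn s L.-1 < L)%N by rewrite -[ltnRHS](prednK L0) ltnS geq_minr.
  by have := none (Ordinal lk); rewrite /= lL /= => ->.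
have beta_eq S s : S \in Q -> s \in S -> minn s L.-1 = beta S :> nat.
  by move=> /betaP[_ /fintype.subsetP H] /H; rewrite inE => /eqP.
apply: (@le_trans _ _ (\prod_(S in Q) (c * enorm hs`_(beta S)))).
  apply: ler_prod => S SQ; rewrite Pset_ge0/=; have [s sS] := mem_nonempty S SQ.
  apply: le_trans (@Pset_collapse _ n _ x hs S s sS L0) _.
  rewrite -/L (beta_eq S)//; case: ifP => // _.
  by rewrite mulr_ge0 ?enorm_ge0// (le_trans ler01).
rewrite big_split /= prodr_const; apply: ler_pM.
- by rewrite exprn_ge0// (le_trans ler01).
- by rewrite prodr_ge0// => S _; exact: enorm_ge0.
- by rewrite ler_weXn2l// max_card.
rewrite (partition_big beta (fun j => (j < L)%N)) => [|S /betaP[]//] /=.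
apply: ler_prod => j jL; rewrite prodr_ge0/= => [|S _]; last exact: enorm_ge0.
have jQ : j \in finset.cover Q by rewrite covQ inE.
have jS : j \in finset.pblock Q j by rewrite mem_pblock.
have SQ := pblock_mem jQ.
have bj : beta (finset.pblock Q j) = j.
  apply: val_inj; rewrite /= -(beta_eq _ _ SQ jS); apply/minn_idPl.
  by rewrite -ltnS prednK.
rewrite (bigD1 (finset.pblock Q j)) ?SQ ?bj ?eqxx//= ler_piMr ?enorm_ge0//.
apply: prodr_ile1 => S /andP[/andP[_ /eqP ->] _].
by rewrite enorm_ge0 h1// mem_nth.
Qed.

Lemma prod_enorm_nth (R : realType) (n m : nat) (hs : seq 'rV[R]_n) :
  (size hs <= m)%N ->
  \prod_(j < m | (j < size hs)%N) enorm hs`_j = \prod_(h <- hs) enorm h.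
Proof.
move=> hm; rewrite (big_nth 0) big_mkord.
by rewrite (big_ord_widen _ (fun j => enorm hs`_j) hm).
Qed.

(** The partition sums are covered by [prod_Pset_collapse]; in [Ppow] as well,
    there is a factor for each step and the other ones are at most one, up to
    constants. *)
Lemma Pmod_collapse_le (R : realType) (n k : nat) (alpha : R) (x : 'rV[R]_n)
    (hs : seq 'rV[R]_n) : 0 < alpha <= 1 ->
  (0 < size hs <= k)%N -> (forall h, h \in hs -> enorm h <= 1) ->
  Pmod (k%:R + alpha) (collapse (k := k) x hs) <=
  (#|{set 'I_k.+1}|%:R ^+ k.+1 +
   #|{set {set 'I_k.+1}}|%:R * #|{set 'I_k.+1}|%:R ^+ #|{set 'I_k.+1}|) *
  \prod_(h <- hs) enorm h.
Proof.
set c : R := #|{set 'I_k.+1}|%:R.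
move=> /andP[a0 a1] /andP[L0 Lk] h1; have Lk' := leqW Lk.
have c1 : 1 <= c by rewrite /c ler1n; apply/card_gt0P; exists finset.set0.
have c0 := le_trans ler01 c1.
have h0 : 0 <= \prod_(h <- hs) enorm h by rewrite prodr_ge0// => *;
  exact: enorm_ge0.
rewrite /Pmod mulrDl -partition_weight_Pset lerD//; last first.
  apply: (@le_trans _ _ (\sum_(Q : {set {set 'I_k.+1}})
      c ^+ #|{set 'I_k.+1}| * \prod_(h <- hs) enorm h)); last first.
    by rewrite sumr_const -[leLHS]mulr_natl mulrA.
  rewrite [leRHS](bigID (fun Q => finset.partition Q [set: 'I_k.+1]%SET &&
    (#|Q| < k.+1)%N))/= ler_wpDr//.
    by rewrite sumr_ge0// => Q _; rewrite mulr_ge0// exprn_ge0.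
  apply: ler_sum => Q /andP[QT _]; rewrite -(prod_enorm_nth Lk').
  by apply: prod_Pset_collapse; rewrite ?L0.
have Ps (j : 'I_k.+1) : Pset (collapse x hs) [set j]%SET <=
    c * enorm hs`_(minn j (size hs).-1).
  apply: (le_trans (@Pset_collapse _ _ _ x hs [set j]%SET j (finset.set11 _) L0)).
  by case: ifP => // _; rewrite mulr_ge0 ?enorm_ge0.
have lL j : (minn j (size hs).-1 < size hs)%N.
  by rewrite -[ltnRHS](prednK L0) ltnS geq_minr.
rewrite /Ppow addrAC subrr add0r exprS -mulrA; apply: ler_pM.
- exact: powR_ge0.
- by rewrite prodr_ge0// => j _; exact: Pset_ge0.
- have Pc : Pset (collapse x hs) [set (ord_max : 'I_k.+1)]%SET <= c.
    by apply: (le_trans (Ps _)); rewrite ler_piMr// h1// mem_nth.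
  apply: le_trans (ge0_ler_powR (ltW a0) _ _ Pc) _; rewrite ?nnegrE ?Pset_ge0//.
  exact: ler1_powR.
apply: (@le_trans _ _ (\prod_(j < k.+1 | (j < k)%N)
    (c * enorm hs`_(minn j (size hs).-1)))).
  by apply: ler_prod => j _; rewrite Pset_ge0 Ps.
rewrite big_split/= ler_pM//.
- by rewrite prodr_ge0.
- by rewrite prodr_ge0// => j _; exact: enorm_ge0.
- rewrite -(big_ord_widen _ (fun=> c) (leqnSn k)) prodr_const card_ord//.
rewrite -(prod_enorm_nth Lk') (bigID (fun j : 'I_k.+1 => (j < size hs)%N))/=.
rewrite -[leRHS]mulr1 ler_pM//.
- by rewrite prodr_ge0// => j _; exact: enorm_ge0.
- by rewrite prodr_ge0// => j _; exact: enorm_ge0.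
- rewrite (eq_bigl (fun j : 'I_k.+1 => (j < size hs)%N)) => [|j]; last first.
    by rewrite andb_idl// => jL; exact: leq_trans jL Lk.
  rewrite le_eqVlt; apply/orP; left; apply/eqP/eq_bigr => j jL.
  by rewrite (minn_idPl _)// -ltnS prednK.
by apply: prodr_ile1 => j _; rewrite enorm_ge0 h1// mem_nth.
Qed.

(** For a parallelepiped every difference over two directions vanishes, so
    that the partition sums are zero and only [Ppow] survives. Nothing is
    assumed on the lengths of the steps; in particular [h0] may join two
    points that are far apart. *)
Lemma Pmod_parallelepiped_le (R : realType) (n k : nat) (alpha : R)
    (x h0 : 'rV[R]_n) (hs : seq 'rV[R]_n) : 0 < alpha <= 1 -> size hs = k ->
  Pmod (k%:R + alpha) (collapse (k := k) x (rcons hs h0)) <=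
  #|{set 'I_k.+1}|%:R ^+ k.+1 *
  (enorm h0 `^ alpha * \prod_(h <- hs) enorm h).
Proof.
set c : R := #|{set 'I_k.+1}|%:R.
move=> /andP[a0 a1] hk.
have c1 : 1 <= c by rewrite /c ler1n; apply/card_gt0P; exists finset.set0.
have c0 := le_trans ler01 c1.
have sz : size (rcons hs h0) = k.+1 by rewrite size_rcons hk.
have mk (j : 'I_k.+1) : minn j k = j by apply/minn_idPl; rewrite -ltnS.
have bl (j : 'I_k.+1) : block k k.+1 j = [set j]%SET.
  by apply/finset.setP => i; rewrite !inE /= mk.
have P0 (S : {set 'I_k.+1}) : (1 < #|S|)%N -> Pset (collapse (k :=
  k) x (rcons hs h0)) S = 0.
  move=> S2; have [s sS] : exists s, s \in S.
    by apply/set0Pn; rewrite -card_gt0 (ltn_trans _ S2).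
  apply/eqP; rewrite eq_le Pset_ge0 andbT.
  apply: (le_trans (@Pset_collapse _ _ _ x (rcons hs h0) S s sS _)).
    by rewrite sz.
  rewrite sz /= mk bl ifN//.
  by apply: contraTN S2 => /subset_leq_card; rewrite cards1 -leqNgt.
have Pj (j : 'I_k.+1) : Pset (collapse (k := k) x (rcons hs h0)) [set j]%SET <=
    c * enorm (rcons hs h0)`_j.
  apply: (le_trans (@Pset_collapse _ _ _ x _ [set j]%SET j (finset.set11 _) _)).
    by rewrite sz.
  by rewrite sz /= mk bl fintype.subxx.
rewrite /Pmod -partition_weight_Pset [X in _ + X]big1 ?addr0; last first.
  move=> Q /andP[QT Qk].
  have [/existsP[S /andP[SQ S2]]|/existsPn nex] :=
      boolP [exists S in Q, (1 < #|S|)%N].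
    by rewrite (bigD1 S)//= P0 ?mul0r.
  have := card_partition QT; rewrite cardsT card_ord => kQ.
  suff : (k.+1 <= #|Q|)%N by rewrite leqNgt Qk.
  rewrite {1}kQ -sum1_card leq_sum// => S SQ.
  by have := nex S; rewrite SQ/= -leqNgt.
rewrite /Ppow addrAC subrr add0r.
apply: (@le_trans _ _ ((c * enorm h0) `^ alpha *
   \prod_(j < k.+1 | (j < k)%N) (c * enorm (rcons hs h0)`_j))).
  apply: ler_pM.
  - exact: powR_ge0.
  - by rewrite prodr_ge0// => j _; exact: Pset_ge0.
  - apply: (ge0_ler_powR (ltW a0));
    rewrite ?nnegrE ?Pset_ge0 ?mulr_ge0 ?enorm_ge0//.
    by apply: (le_trans (Pj _)); rewrite /= nth_rcons hk ltnn eqxx.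
  - by apply: ler_prod => j _; rewrite Pset_ge0 Pj.
rewrite powRM ?enorm_ge0// big_split /=.
rewrite -(big_ord_widen _ (fun=> c) (leqnSn k)) prodr_const card_ord.
rewrite (eq_bigr (fun j : 'I_k.+1 => enorm hs`_j)); last first.
  by move=> j jk; rewrite nth_rcons hk jk.
have -> : \prod_(j < k.+1 | (j < k)%N) enorm hs`_j = \prod_(h <- hs) enorm h.
  by rewrite -(@prod_enorm_nth _ _ k.+1) hk.
rewrite exprS.
rewrite mulrACA ler_wpM2r ?mulr_ge0 ?powR_ge0//.
  by rewrite prodr_ge0// => j _; exact: enorm_ge0.
by rewrite ler_wpM2r ?exprn_ge0// ler1_powR.
Qed.

(** * Differentiability from second differences *)

Section SecondDifference.
Variables (R : realType) (V : normedModType R) (g : V -> R) (x : V).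
Variables (C d alpha : R).
Hypotheses (C0 : 0 <= C) (d0 : 0 < d) (alpha0 : 0 < alpha).
Hypothesis g_lip : forall y h : V, `|y - x| < d -> `|h| < d ->
  `|g (y + h) - g y| <= C * `|h|.
Hypothesis g_diff2 : forall h h' : V, `|h| < d -> `|h'| < d ->
  `|g (x + h + h') - g (x + h) - g (x + h') + g x| <= C * `|h| * `|h'| `^ alpha.

Local Notation D h := (g (x + h) - g x).

Let powRl (a b : R) : 0 <= a -> a <= b -> a `^ alpha <= b `^ alpha.
Proof.
move=> a0 ab; apply: (ge0_ler_powR (ltW alpha0)); rewrite ?nnegrE//.
exact: le_trans ab.
Qed.

(** The increments of [g] over [N] consecutive steps [u] differ from the first
    one by second differences. *)
Lemma increment_mulrn (u : V) (m : R) (N : nat) : N%:R * `|u| <= m -> m < d ->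
  `|D (u *+ N) - N%:R * D u| <= N%:R * (C * `|u| * m `^ alpha).
Proof.
move=> Nm md; elim: N Nm => [|N IH] Nm.
  by rewrite mulr0n addr0 subrr !mul0r subr0 normr0.
have m0 : 0 <= m by apply: le_trans Nm; rewrite mulr_ge0.
have N1 : N%:R * `|u| <= m.
  by apply: le_trans Nm; rewrite ler_wpM2r// ler_nat.
have u1 : `|u| <= m.
  by apply: le_trans Nm; rewrite ler_peMl// ler1n.
have E : D (u *+ N.+1) - N.+1%:R * D u =
   (D (u *+ N) - N%:R * D u) + (g (x + u + u *+ N) - g (x + u) - g (x + u *+ N)
     + g x).
  by rewrite mulrS addrA -natr1; ring.
rewrite E -natr1 mulrDl mul1r; apply: (le_trans (ler_normD _ _)).
apply: lerD; first exact: IH.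
have uN : `|u *+ N| <= m by rewrite normrMn -mulr_natl.
apply: (le_trans (g_diff2 (le_lt_trans u1 md) (le_lt_trans uN md))).
by rewrite ler_wpM2l ?mulr_ge0// powRl.
Qed.

(** Writing [s^-1] as an integer plus a remainder below one, the integer part
    is [increment_mulrn] and the remainder is controlled by the Lipschitz
    bound. *)
Lemma increment_scale (h : V) (s : R) : `|h| < d -> 0 < s <= 1 ->
  `|s * D h - D (s *: h)| <= s * (C * `|h| * `|h| `^ alpha + 2 * s * C * `|h|).
Proof.
move=> hd /andP[s0 s1].
set N := Num.truncn s^-1.
have is0 : 0 <= s^-1 by rewrite invr_ge0 ltW.
have /andP[Nl Nu] := truncn_itv is0; rewrite -/N in Nl Nu.
have Ns : N%:R * s <= 1 by rewrite -ler_pdivlMr// mul1r.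
have Ns' : 1 - N%:R * s <= s.
  by move: Nu; rewrite -natr1 -[_^-1]mul1r ltr_pdivrMr// => /ltW; lra.
have nu : `|s *: h| = s * `|h| by rewrite normrZ gtr0_norm.
have nuN : N%:R * `|s *: h| <= `|h| by rewrite nu mulrA ler_piMl.
have H1 := increment_mulrn nuN hd.
have sd : `|s *: h| < d by rewrite nu (le_lt_trans _ hd)// ler_piMl.
have H2 : `|D (s *: h)| <= C * (s * `|h|).
  by rewrite -nu g_lip// subrr normr0.
have uN : `|(s *: h) *+ N| <= `|h| by rewrite normrMn -mulr_natl.
have H3 : `|D h - D ((s *: h) *+ N)| <= C * (s * `|h|).
  have -> : D h - D ((s *: h) *+ N) = g (x + (s *: h) *+ N + (h - (s *: h) *+ N)) -
      g (x + (s *: h) *+ N).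
    rewrite -(addrA x) (_ : (s *: h) *+ N + (h - (s *: h) *+ N) = h); first by ring.
    by rewrite addrC subrK.
  have e : `|h - (s *: h) *+ N| = (1 - N%:R * s) * `|h|.
    by rewrite -scaler_nat scalerA -{1}[h]scale1r -scalerBl normrZ ger0_norm//
      subr_ge0.
  apply: le_trans (g_lip _ _) _.
  - by rewrite addrC addKr (le_lt_trans uN).
  - by rewrite e (le_lt_trans _ hd)// ler_piMl// gerBl mulr_ge0// ltW.
  by rewrite ler_wpM2l// e ler_wpM2r.
have -> : s * D h - D (s *: h) = s * (D h - D ((s *: h) *+ N)) +
    (s * (D ((s *: h) *+ N) - N%:R * D (s *: h)) +
    - (1 - N%:R * s) * D (s *: h)) by ring.
have -> : s * (C * `|h| * `|h| `^ alpha + 2 * s * C * `|h|) =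
    s * (C * (s * `|h|)) + (s * (C * `|h| * `|h| `^ alpha) + s * (C * (s * `|h|))).
  by ring.
apply: (le_trans (ler_normD _ _)); apply: lerD.
  by rewrite normrM gtr0_norm// ler_pM2l.
apply: (le_trans (ler_normD _ _)); apply: lerD.
  rewrite normrM gtr0_norm// ler_pM2l//; apply: (le_trans H1).
  rewrite nu (_ : N%:R * _ = (N%:R * s) * (C * `|h| * `|h| `^ alpha)); last by ring.
  by rewrite ler_piMl// !mulr_ge0// powR_ge0.
rewrite mulNr normrN normrM ger0_norm ?subr_ge0//.
by rewrite ler_pM// subr_ge0.
Qed.

(** A second difference with opposite steps compares the quotients at [s] and
    at [- s]. *)
Lemma increment_opp (h : V) (s : R) : s != 0 -> `|s *: h| < d ->
  `|s^-1 * D (s *: h) - `|s|^-1 * D (`|s| *: h)| <=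
    C * `|h| * (`|s| * `|h|) `^ alpha.
Proof.
move=> s0 sd; have [sn|sp|e] := ltgtP s 0; last by rewrite e eqxx in s0.
  rewrite [`|s|]ltr0_norm// scaleNr.
  have sd' : `|- (s *: h)| < d by rewrite normrN.
  have n1 : `|s *: h| = - s * `|h| by rewrite normrZ ltr0_norm.
  have n2 : `|- (s *: h)| = - s * `|h| by rewrite normrN.
  have := g_diff2 sd sd'; rewrite addrK n1 n2.
  have -> : g x - g (x + s *: h) - g (x - s *: h) + g x =
     - s * (s^-1 * D (s *: h) - (- s)^-1 * D (- (s *: h))).
    by rewrite invrN; field.
  rewrite normrM (gtr0_norm (_ : 0 < - s)) ?oppr_gt0//.
  rewrite (_ : C * (- s * `|h|) * _ =
    - s * (C * `|h| * (- s * `|h|) `^ alpha)); last by ring.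
  by rewrite ler_pM2l// oppr_gt0.
by rewrite [`|s|]gtr0_norm// subrr normr0 !mulr_ge0// powR_ge0.
Qed.


Let powR_small (A B e : R) : 0 <= A -> 0 <= B -> 0 < e ->
  exists2 eta, 0 < eta & forall s, 0 <= s < eta -> A * (s * B) `^ alpha <= e.
Proof.
move=> A0 B0 e0; have P0 : 0 <= A * B `^ alpha by rewrite mulr_ge0 ?powR_ge0.
have P1 : 0 < A * B `^ alpha + 1 by rewrite ltr_wpDl.
exists ((e / (A * B `^ alpha + 1)) `^ alpha^-1);
  first by rewrite powR_gt0// divr_gt0.
move=> s /andP[s0 /ltW/(powRl s0)]; rewrite -powRrM mulVf ?gt_eqF// powRr1;
  last first.
  by rewrite divr_ge0 ?ltW.
move=> se; rewrite powRM//.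
apply: (@le_trans _ _ (A * B `^ alpha * (e / (A * B `^ alpha + 1)))).
  by rewrite mulrCA mulrC ler_wpM2l.
by rewrite mulrA ler_pdivrMr// mulrC ler_pM2l// lerDl.
Qed.

(** The difference quotients are Cauchy: the one at a fixed small [t] is close
    to all those at [s] much smaller than [t]. *)
Lemma derivable_second_diff (v : V) : derivable g x v.
Proof.
apply/cauchy_cvgP/cauchy_exP => e e0.
have e4 : 0 < e / 4 by rewrite divr_gt0.
have [eta eta0 Heta] := powR_small (mulr_ge0 C0 (normr_ge0 v)) (normr_ge0 v) e4.
have v1 : 0 < `|v| + 1 by rewrite ltr_wpDl.
pose t := Num.min (eta / 2) (d / (`|v| + 1)).
have t0 : 0 < t by rewrite lt_min !divr_gt0.
have tv : `|t *: v| < d.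
  rewrite normrZ gtr0_norm// (@lt_le_trans _ _ (t * (`|v| + 1)))//.
    by rewrite ltr_pM2l// ltrDl.
  by rewrite -ler_pdivlMr// ge_min lexx orbT.
have teta : 0 <= t < eta.
  by rewrite ltW//= gt_min ltr_pdivrMr// ltr_pMr// ltr1n.
have Ht := Heta _ teta.
(* The second entry makes the Lipschitz term of [increment_scale] at most [e
   / 4]; the added 1 keeps the denominator positive. *)
pose eta2 := Num.min t (t * e / 4 / (2 * C * `|v| + 1)).
have Cv : 0 <= 2 * C * `|v| by rewrite !mulr_ge0.
have Cv1 : 0 < 2 * C * `|v| + 1 by rewrite ltr_wpDl.
have eta20 : 0 < eta2 by rewrite lt_min t0 !divr_gt0// mulr_gt0.
exists (t^-1 * D (t *: v)).
rewrite /= /dnbhs /within /=; apply/nbhs_ballP; exists eta2 => //= s.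
rewrite /ball/= sub0r normrN => ss s0.
rewrite /ball /= [s *: v + x]addrC -[s^-1 *: _]/(s^-1 * D (s *: v)).
have st : `|s| < t by rewrite (lt_le_trans ss)// ge_min lexx.
have sp : 0 < `|s| by rewrite normr_gt0.
have sv : `|s *: v| < d.
  by rewrite normrZ (le_lt_trans _ tv)// normrZ [`|t|]gtr0_norm// ler_wpM2r// ltW.
have H1 : `|s^-1 * D (s *: v) - `|s|^-1 * D (`|s| *: v)| <= e / 4.
  apply: (le_trans (increment_opp s0 sv)); apply: le_trans Ht.
  rewrite ler_wpM2l ?mulr_ge0//; apply: powRl; first by rewrite mulr_ge0.
  by rewrite ler_wpM2r// ltW.
have st1 : 0 < `|s| / t <= 1 by rewrite divr_gt0//= ler_pdivrMr// mul1r ltW.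
have := increment_scale tv st1.
rewrite scalerA divfK ?gt_eqF// normrZ [`|t|]gtr0_norm// => H2.
have H3 : `|t^-1 * D (t *: v) - `|s|^-1 * D (`|s| *: v)| <=
    C * `|v| * (t * `|v|) `^ alpha + 2 * C * `|v| * (`|s| / t).
  rewrite -(ler_pM2l sp) -{1}[`|s|]normr_id -normrM.
  have -> : `|s| * (t^-1 * D (t *: v) - `|s|^-1 * D (`|s| *: v)) =
     `|s| / t * D (t *: v) - D (`|s| *: v) by field; rewrite ?gt_eqF// normr_eq0.
  apply: (le_trans H2); rewrite le_eqVlt; apply/orP; left; apply/eqP.
  by field; rewrite gt_eqF.
have H4 : 2 * C * `|v| * (`|s| / t) <= e / 4.
  apply: (@le_trans _ _ ((2 * C * `|v| + 1) * (`|s| / t))).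
    by rewrite ler_wpM2r ?lerDl// divr_ge0// ltW.
  rewrite mulrA ler_pdivrMr// mulrC -ler_pdivlMr//.
  have : `|s| <= t * e / 4 / (2 * C * `|v| + 1).
    by apply: ltW; apply: (lt_le_trans ss); rewrite ge_min lexx orbT.
  by rewrite (_ : e / 4 * t = t * e / 4)//; ring.
rewrite (_ : t^-1 * _ - _ = (t^-1 * D (t *: v) - `|s|^-1 * D (`|s| *: v)) -
  (s^-1 * D (s *: v) - `|s|^-1 * D (`|s| *: v))); last by ring.
apply: (le_lt_trans (ler_normB _ _)).
by apply: (le_lt_trans (lerD H3 H1)); lra.
Qed.

Lemma derive_eps (v : V) (e : R) : 0 < e ->
  exists2 eta, 0 < eta &
    forall s, `|s| < eta -> `|D (s *: v) - s * 'D_v g x| <= e * `|s|.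
Proof.
move=> e0; have dv : derivable g x v by exact: derivable_second_diff.
move: dv => /cvgrPdist_le/(_ _ e0);
  rewrite near_withinE => /nbhs_ballP[eta /= eta0 H]; exists eta => // s seta.
have [->|s0] := eqVneq s 0.
  by rewrite scale0r addr0 subrr mul0r subr0 !normr0 mulr0.
have := H s; rewrite /ball /= sub0r normrN => /(_ seta s0).
rewrite [s *: v + x]addrC -[s^-1 *: _]/(s^-1 * D (s *: v)) => Hs.
rewrite -ler_pdivrMr ?normr_gt0// -normfV -normrM.
rewrite (_ : _ / s = - ('D_v g x - s^-1 * D (s *: v))); last by field.
by rewrite normrN.
Qed.

(** Letting [s] tend to zero in [increment_scale]. *)
Lemma derive_second_diff_le (h : V) : `|h| < d ->
  `|D h - 'D_h g x| <= C * `|h| * `|h| `^ alpha.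
Proof.
move=> hd; apply/ler_addgt0Pr => e e0.
pose k := 2 * C * `|h| + 1.
have Ch : 0 <= 2 * C * `|h| by rewrite !mulr_ge0.
have k0 : 0 < k by rewrite ltr_wpDl.
have ek : 0 < e / k by rewrite divr_gt0.
have [eta eta0 H] := derive_eps h ek.
pose s := Num.min (Num.min 1 (e / k)) (eta / 2).
have s0 : 0 < s by rewrite !lt_min ltr01 ek divr_gt0.
have s1 : s <= 1 by rewrite !ge_min lexx.
have se : s <= e / k by rewrite !ge_min lexx orbT.
have seta : `|s| < eta.
  rewrite gtr0_norm// (@le_lt_trans _ _ (eta / 2))//;
    first by rewrite !ge_min lexx !orbT.
  by rewrite ltr_pdivrMr// ltr_pMr// ltr1n.
have H1 := H s seta; rewrite [`|s|]gtr0_norm// in H1.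
have s01 : 0 < s <= 1 by rewrite s0.
have H2 := increment_scale hd s01.
rewrite -(ler_pM2l s0) -{1}(gtr0_norm s0) -normrM.
have -> : s * (D h - 'D_h g x) =
  (s * D h - D (s *: h)) + (D (s *: h) - s * 'D_h g x).
  by ring.
apply: (le_trans (ler_normD _ _)); apply: (le_trans (lerD H2 H1)).
have -> : s * (C * `|h| * `|h| `^ alpha + 2 * s * C * `|h|) + e / k * s =
    s * (C * `|h| * `|h| `^ alpha + (s * (2 * C * `|h|) + e / k)) by ring.
rewrite ler_pM2l// lerD2l.
apply: (@le_trans _ _ (e / k * (2 * C * `|h|) + e / k)).
  by rewrite lerD2r ler_wpM2r.
by rewrite -[X in _ + X]mulr1 -mulrDr -/k divfK ?gt_eqF.
Qed.

Let eq_eps (a b k : R) : 0 < k -> (forall e, 0 < e -> `|a - b| <= e * k) -> a = b.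
Proof.
move=> k0 H; apply/eqP; rewrite -subr_eq0 -normr_le0; apply/ler_addgt0Pr => e e0.
by have := H (e / k) (divr_gt0 e0 k0); rewrite divfK ?gt_eqF// add0r.
Qed.

Let derive_homog (a : R) (v : V) : 'D_(a *: v) g x = a * 'D_v g x.
Proof.
apply: (@eq_eps _ _ (1 + `|a|)) => [|e e0]; first by rewrite ltr_wpDr.
have [eta1 eta10 H1] := derive_eps (a *: v) e0.
have [eta2 eta20 H2] := derive_eps v e0.
have a1 : 0 < `|a| + 1 by rewrite ltr_wpDl.
pose s := Num.min (eta1 / 2) (eta2 / 2 / (`|a| + 1)).
have s0 : 0 < s by rewrite lt_min !divr_gt0.
have s1 : `|s| < eta1.
  rewrite gtr0_norm// (@le_lt_trans _ _ (eta1 / 2))//; first by rewrite ge_min lexx.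
  by rewrite ltr_pdivrMr// ltr_pMr// ltr1n.
have s2 : `|s * a| < eta2.
  rewrite normrM gtr0_norm// (@le_lt_trans _ _ (eta2 / 2))//; last first.
    by rewrite ltr_pdivrMr// ltr_pMr// ltr1n.
  apply: (@le_trans _ _ (s * (`|a| + 1))); first by rewrite ler_wpM2l ?lerDl// ltW.
  by rewrite -ler_pdivlMr// ge_min lexx orbT.
have {}H1 := H1 s s1; have {}H2 := H2 (s * a) s2; rewrite -scalerA in H2.
rewrite -(ler_pM2l s0) -{1}(gtr0_norm s0) -normrM.
have -> : s * ('D_(a *: v) g x - a * 'D_v g x) =
    (D (s *: (a *: v)) - s * a * 'D_v g x) - (D (s *: (a *: v)) - s * 'D_(a *:
      v) g x).
  by ring.
apply: (le_trans (ler_normB _ _)); apply: (le_trans (lerD H2 H1)).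
by rewrite normrM gtr0_norm// le_eqVlt; apply/orP; left; apply/eqP; ring.
Qed.

(** The defect of additivity of the increments over [s *: u] and [s *: w] is a
    second difference, which is small compared with [s]. *)
Let derive_add (u w : V) : 'D_(u + w) g x = 'D_u g x + 'D_w g x.
Proof.
apply: (@eq_eps _ _ 4) => // e e0.
have [eta1 eta10 H1] := derive_eps (u + w) e0.
have [eta2 eta20 H2] := derive_eps u e0.
have [eta3 eta30 H3] := derive_eps w e0.
have [eta4 eta40 H4] := powR_small (mulr_ge0 C0 (normr_ge0 u)) (normr_ge0 w) e0.
have uw1 : 0 < `|u| + `|w| + 1 by rewrite ltr_wpDl// addr_ge0.
pose m := Num.min (Num.min eta1 eta2) (Num.min (Num.min eta3 eta4) (d / (`|u| +
  `|w| + 1))).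
have m0 : 0 < m by rewrite !lt_min eta10 eta20 eta30 eta40 divr_gt0.
have [s s0 sm] : exists2 s, 0 < s & s < m.
  by exists (m / 2); rewrite ?divr_gt0// ltr_pdivrMr// ltr_pMr// ltr1n.
have [s1 s2] : `|s| < eta1 /\ `|s| < eta2.
  by rewrite gtr0_norm//; split; apply: (lt_le_trans sm);
    rewrite !ge_min lexx ?orbT.
have [s3 s4] : `|s| < eta3 /\ 0 <= s < eta4.
  rewrite gtr0_norm// ltW//=.
  by split; apply: (lt_le_trans sm); rewrite !ge_min lexx ?orbT.
have sd : s * (`|u| + `|w| + 1) < d.
  rewrite -ltr_pdivlMr//; apply: (lt_le_trans sm).
  by rewrite !ge_min lexx !orbT.
have sz (z : V) : `|z| <= `|u| + `|w| -> `|s *: z| < d.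
  move=> zuw; apply: le_lt_trans sd; rewrite normrZ gtr0_norm//.
  by rewrite ler_wpM2l ?(ltW s0)// (le_trans zuw)// lerDl.
have := g_diff2 (sz u _) (sz w _); rewrite lerDl lerDr !normr_ge0 => /(_ isT isT).
rewrite !normrZ [`|s|]gtr0_norm// => H5.
have {}H1 := H1 _ s1; have {}H2 := H2 _ s2; have {}H3 := H3 _ s3;
  have {}H4 := H4 _ s4.
rewrite [`|s|]gtr0_norm// in H1 H2 H3.
rewrite -(ler_pM2l s0) -{1}(gtr0_norm s0) -normrM.
have -> : s * ('D_(u + w) g x - ('D_u g x + 'D_w g x)) =
    (g (x + s *: u + s *: w) - g (x + s *: u) - g (x + s *: w) + g x) -
    (D (s *: (u + w)) - s * 'D_(u + w) g x) +
    (D (s *: u) - s * 'D_u g x) + (D (s *: w) - s * 'D_w g x).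
  by rewrite scalerDr (addrA x); ring.
have {}H5 : `|g (x + s *: u + s *: w) - g (x + s *: u) - g (x + s *: w) + g x|
  <= s * e.
  apply: (le_trans H5).
  rewrite (_ : _ * _ * _ = s * (C * `|u| * (s * `|w|) `^ alpha)); last by ring.
  by rewrite ler_pM2l.
apply: (le_trans (ler_normD _ _)).
rewrite (_ : s * (e * 4) = s * e + e * s + e * s + e * s); last by ring.
apply: lerD => //; apply: (le_trans (ler_normD _ _)); apply: lerD => //.
by apply: (le_trans (ler_normB _ _)); apply: lerD.
Qed.

Let derive_le (v : V) : `|'D_v g x| <= C * `|v|.
Proof.
apply/ler_addgt0Pr => e e0; have [eta eta0 H] := derive_eps v e0.
have v1 : 0 < `|v| + 1 by rewrite ltr_wpDl.
pose s := Num.min (eta / 2) (d / (`|v| + 1)).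
have s0 : 0 < s by rewrite lt_min !divr_gt0.
have s1 : `|s| < eta.
  rewrite gtr0_norm// (@le_lt_trans _ _ (eta / 2))//; first by rewrite ge_min lexx.
  by rewrite ltr_pdivrMr// ltr_pMr// ltr1n.
have sd : `|s *: v| < d.
  rewrite normrZ gtr0_norm// (@lt_le_trans _ _ (s * (`|v| + 1)))//.
    by rewrite ltr_pM2l// ltrDl.
  by rewrite -ler_pdivlMr// ge_min lexx orbT.
have {}H := H s s1; rewrite [`|s|]gtr0_norm// in H.
have H1 : `|D (s *: v)| <= s * (C * `|v|).
  by rewrite mulrCA -[s in s * `|v|]gtr0_norm// -normrZ g_lip// subrr normr0.
rewrite -(ler_pM2l s0) -{1}(gtr0_norm s0) -normrM.
rewrite (_ : s * 'D_v g x = D (s *: v) - (D (s *: v) - s * 'D_v g x)); last by ring.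
apply: (le_trans (ler_normB _ _)); rewrite mulrDr; apply: lerD => //.
by rewrite [leRHS]mulrC.
Qed.

(** The directional derivatives form a bounded linear map, and
    [derive_second_diff_le] is uniform in the direction. *)
Lemma differentiable_second_diff : differentiable g x.
Proof.
pose F (v : V) := 'D_v g x : R^o.
have linF : linear F by move=> a u w; rewrite /F derive_add derive_homog.
pose Fl : {linear V -> R^o} := HB.pack F (GRing.isLinear.Build R V R^o *:%R F linF).
have contF : continuous (Fl : V -> R^o).
  apply: bounded_linear_continuous; apply/linear_boundedP.
  near=> r => v; apply: (le_trans (derive_le v)).
  by rewrite ler_wpM2r//; near: r; exact: nbhs_pinfty_ge.
have expF : g \o shift x = cst (g x) + (Fl : V -> R^o) +o_ (0 : V) id.
  apply/eqaddoP => e e0.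
  have [eta eta0 H] := powR_small C0 ler01 e0.
  apply/nbhs_ballP; exists (Num.min eta d); first by rewrite /= lt_min eta0.
  move=> v; rewrite -ball_normE /ball_/= sub0r normrN lt_min => /andP[veta vd].
  have := derive_second_diff_le vd.
  have {}H := H `|v|; rewrite mulr1 normr_ge0 veta in H.
  rewrite [x + v]addrC => H1.
  rewrite (_ : (_ - _ : V -> R^o) v = g (v + x) - g x - 'D_v g x); last first.
    by rewrite /= opprD addrA.
  apply: (le_trans H1); rewrite mulrAC ler_wpM2r//; exact: H.
have dF := diff_unique contF expF.
by apply/diff_locallyP; rewrite dF.
Unshelve. all: by end_near. Qed.

End SecondDifference.

(** * Regularity from bounds on differences *)

(** The bounds on [Pmod] for collapsed tuples, read through the definition of
    a gradient. *)
Lemma Dgrad_diff_le (R : realType) (n k : nat) (alpha : R) :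
  0 < alpha <= 1 ->
  exists2 K : R, 0 <= K &
    forall (Omega : set 'rV[R]_n) (f : 'rV[R]_n -> R)
      (G : 'rV[R]_n -> \bar R) (c : R), 0 <= c ->
      Dgrad k (k%:R + alpha) Omega f G ->
      (forall y, Omega y -> (G y <= c%:E)%E) ->
      (forall hs x, (0 < size hs <= k)%N ->
         (forall h, h \in hs -> enorm h <= 1) -> vertices_in Omega hs x ->
         `|iterdiff hs f x| <= K * c * \prod_(h <- hs) enorm h) /\
      (forall hs h0 x, size hs = k -> vertices_in Omega (rcons hs h0) x ->
         `|iterdiff (rcons hs h0) f x| <=
         K * c * (enorm h0 `^ alpha * \prod_(h <- hs) enorm h)).
Proof.
move=> a01.
set c0 : R := #|{set 'I_k.+1}|%:R.
set K1 := c0 ^+ k.+1 + #|{set {set 'I_k.+1}}|%:R * c0 ^+ #|{set 'I_k.+1}|.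
set K2 := c0 ^+ k.+1.
have c00 : 0 <= c0 by rewrite ler0n.
have K10 : 0 <= K1 by rewrite addr_ge0// ?mulr_ge0// exprn_ge0.
have K20 : 0 <= K2 by rewrite exprn_ge0.
exists ((K1 + K2) * c0) => [|Omega f G c cge0 [G0 fG] Gc].
  by rewrite mulr_ge0// addr_ge0.
have main hs x (B : R) : (0 < size hs <= k.+1)%N -> vertices_in Omega hs x ->
    Pmod (k%:R + alpha) (collapse (k := k) x hs) <= B ->
    `|iterdiff hs f x| <= B * (c0 * c).
  move=> hsk xO PB.
  have XO I : Omega (collapse (k := k) x hs I).
    by apply: vertices_in_collapse => //; case/andP: hsk.
  have := fG _ XO; rewrite -(cdiff_collapse f x hsk).
  have -> : cdiff [set: 'I_k.+1]%SET (f \o collapse x hs : _ -> R^o) finset.set0 =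
      \sum_(I : {set 'I_k.+1}) (-1) ^+ #|~: I| * f (collapse x hs I).
    rewrite /cdiff; apply: eq_big => [I|I _]; first by rewrite finset.subsetT.
    by rewrite finset.setTD finset.setU0.
  move=> H; rewrite -lee_fin; apply: (le_trans H); rewrite EFinM.
  apply: lee_pmul.
  - by rewrite lee_fin; exact: Pmod_ge0.
  - by apply: sume_ge0 => I _; exact: G0.
  - by rewrite lee_fin.
  apply: (@le_trans _ _ (\sum_(I : {set 'I_k.+1}) c%:E)%E).
    by apply: lee_sum => I _; exact: Gc.
  by rewrite sumEFin lee_fin sumr_const /c0 mulr_natl.
have K1l : K1 <= K1 + K2 by rewrite lerDl.
have K2l : K2 <= K1 + K2 by rewrite lerDr.
split=> [hs x hsk h1 xO|hs h0 x hsk xO].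
  have p0 : 0 <= \prod_(h <- hs) enorm h by rewrite prodr_ge0// => *;
    exact: enorm_ge0.
  have hsk' : (0 < size hs <= k.+1)%N by case/andP: hsk => -> /leqW.
  apply: (le_trans (main hs x _ hsk' xO (Pmod_collapse_le x a01 hsk h1))).
  rewrite -/c0 -/K1 (_ : _ * c * _ =
    (K1 + K2) * \prod_(h <- hs) enorm h * (c0 * c)); last by ring.
  by rewrite ler_wpM2r ?mulr_ge0// ler_wpM2r.
have p0 : 0 <= enorm h0 `^ alpha * \prod_(h <- hs) enorm h.
  by rewrite mulr_ge0 ?powR_ge0// prodr_ge0// => *; exact: enorm_ge0.
have hsk' : (0 < size (rcons hs h0) <= k.+1)%N by rewrite size_rcons hsk leqnn.
apply: (le_trans (main _ x _ hsk' xO (Pmod_parallelepiped_le x h0 a01 hsk))).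
rewrite -/c0 -/K2 (_ : _ * c * _ = (K1 + K2) *
  (enorm h0 `^ alpha * \prod_(h <- hs) enorm h) * (c0 * c)); last by ring.
by rewrite ler_wpM2r ?mulr_ge0// ler_wpM2r.
Qed.

(** Here [l] is the number of derivatives that can still be taken. The second
    clause does not restrict the length of [h0]: for [l = 0] it is a Hoelder
    condition between any two points of the domain. *)
Definition diff_bounded (R : realType) (n : nat) (Omega : set 'rV[R]_n)
    (alpha : R) (l : nat) (N : R) (g : 'rV[R]_n -> R) : Prop :=
  (forall hs x, (size hs <= l)%N -> (forall h, h \in hs -> enorm h <= 1) ->
     vertices_in Omega hs x -> `|iterdiff hs g x| <= N * \prod_(h <- hs) enorm h) /\
  (forall hs h0 x, size hs = l -> vertices_in Omega (rcons hs h0) x ->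
     `|iterdiff (rcons hs h0) g x| <=
     N * (enorm h0 `^ alpha * \prod_(h <- hs) enorm h)).

Lemma near_vertices_in (R : realType) (n : nat) (Omega : set 'rV[R]_n)
    (hs : seq 'rV[R]_n) (x : 'rV[R]_n) : open Omega -> vertices_in Omega hs x ->
  \forall y \near x, vertices_in Omega hs y.
Proof.
move=> oO; elim: hs x => [|h hs IH] x /=.
  by move=> xO; apply: open_nbhs_nbhs.
move=> [/IH xh /IH x0].
have c : ((fun y : 'rV[R]_n => y + h) @ x --> x + h)%classic.
  by apply: (@cvgD _ _ _ (nbhs x) _ id (fun=> h)); [exact: cvg_id|exact: cvg_cst].
by near=> y; split; near: y; [exact: (c _ xh)|exact: x0].
Unshelve. all: by end_near. Qed.

Lemma is_derive_translate (R : realType) (n : nat) (F : 'rV[R]_n -> R)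
    (x v h : 'rV[R]_n) (dF : R) :
  is_derive (x + h) v F dF -> is_derive x v (fun y => F (y + h)) dF.
Proof.
move=> [d e].
have E : (fun t : R => t^-1 *: ((F \o shift (x + h)) (t *: v) - F (x + h))) =
  (fun t : R => t^-1 *: (((fun y => F (y + h)) \o shift x) (t *: v) - F (x + h))).
  by apply/funext => t /=; rewrite addrA.
by apply: DeriveDef; rewrite /derivable /derive /= -E.
Qed.

Lemma is_derive_diff (R : realType) (n : nat) (Omega : set 'rV[R]_n)
    (g : 'rV[R]_n -> R) (v : 'rV[R]_n) (hs : seq 'rV[R]_n) (x : 'rV[R]_n) :
  (forall y, Omega y -> derivable g y v) -> vertices_in Omega hs x ->
  is_derive x v (iterdiff hs g) (iterdiff hs ('D_v g) x).
Proof.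
move=> dg; elim: hs x => [|h hs IH] x /=; first by move=> /dg/derivableP.
move=> [xh x0]; apply: is_deriveB; last exact: IH.
by apply: is_derive_translate; exact: IH.
Qed.

(** The difference quotients are bounded by [B]. *)
Lemma is_derive_norm_le (R : realType) (n : nat) (F : 'rV[R]_n -> R)
    (x v : 'rV[R]_n) (d B : R) : is_derive x v F d ->
  (\forall t \near (0 : R), `|F (t *: v + x) - F x| <= B * `|t|) -> `|d| <= B.
Proof.
move=> [dF <-] nearB; apply/ler_addgt0Pr => e e0.
have := dF => /cvgrPdist_le/(_ _ e0); rewrite /= near_withinE => near1.
have near2 := @filterI _ _ (nbhs_filter (0 : R)) _ _ near1 nearB.
have [eta /= eta0 H] := (nbhs_ballP _ _).1 near2.
have eta2 : 0 < eta / 2 by rewrite divr_gt0.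
have [H1 H2] : (fun t : R => (t != 0 ->
  `|'D_v F x - t^-1 *: (F (t *: v + x) - F x)| <= e) /\
    `|F (t *: v + x) - F x| <= B * `|t|) (eta / 2).
  apply: H; rewrite /ball /= sub0r normrN gtr0_norm// ltr_pdivrMr// ltr_pMr//.
  by rewrite ltr1n.
have := H1 (lt0r_neq0 eta2); set D := F _ - F x in H2 * => H3.
rewrite -[X in `|X|](subrK ((eta / 2)^-1 *: D)) addrC.
apply: (le_trans (ler_normD _ _)); apply: lerD => //.
rewrite normrM normfV [X in X^-1]gtr0_norm// mulrC ler_pdivrMr//.
by rewrite [`|eta / 2|]gtr0_norm in H2.
Qed.

Lemma enorm_delta (R : realType) (n : nat) (t : R) (a : 'I_n) :
  enorm (t *: delta_mx 0 a : 'rV[R]_n) = `|t|.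
Proof.
rewrite /enorm (bigD1 a)//= !mxE !eqxx mulr1 big1 ?addr0 ?sqrtr_sqr// => i ia.
by rewrite !mxE (negbTE ia) andbF mulr0 expr0n.
Qed.

(** A difference of the partial derivative is a limit of quotients of a
    difference of [g] with the additional step [t *: delta_mx 0 a], whose
    length is exactly [`|t|]; so the constant is preserved. *)
Lemma diff_bounded_derive (R : realType) (n : nat) (Omega : set 'rV[R]_n)
    (alpha : R) (l : nat) (N : R) (g : 'rV[R]_n -> R) (a : 'I_n) :
  open Omega -> diff_bounded Omega alpha l.+1 N g ->
  (forall y, Omega y -> derivable g y (delta_mx 0 a)) ->
  diff_bounded Omega alpha l N ('D_(delta_mx 0 a) g).
Proof.
move=> oO [B H] dg.
(* Small steps keep the vertices inside the domain, because it is open. *)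
have small (x : 'rV[R]_n) hs : vertices_in Omega hs x ->
    \forall t \near (0 : R), enorm (t *: delta_mx 0 a : 'rV[R]_n) <= 1 /\
      vertices_in Omega (t *: delta_mx 0 a :: hs) x.
  move=> xO.
  have near1 : \forall t \near (0 : R), `|t| <= 1.
    apply/nbhs_ballP; exists 1 => //= t; rewrite /ball /= sub0r normrN; exact: ltW.
  have near2 : \forall t \near (0 : R), vertices_in Omega hs (x + t *: delta_mx
    0 a).
    have c : ((x + t *: delta_mx 0 a : 'rV[R]_n) @[t --> (0 : R)] --> x)%classic.
      rewrite -[X in (_ --> X)%classic]addr0; apply: cvgD; first exact: cvg_cst.
      rewrite -[X in (_ --> X)%classic](scale0r (delta_mx 0 a)).
      by apply: cvgZr_tmp; exact: cvg_id.
    exact: (c _ (near_vertices_in oO xO)).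
  near=> t; split; first by rewrite enorm_delta; near: t.
  by split=> //; near: t.
split=> [hs x hsl h1 xO|hs h0 x hsl xO].
  apply: (is_derive_norm_le (is_derive_diff dg xO)).
  apply: filterS (small x hs xO) => t [t1 tO].
  have := B (t *: delta_mx 0 a :: hs) x hsl _ tO; rewrite /= big_cons enorm_delta.
  rewrite [x + _]addrC (mulrC `|t|) mulrA; apply.
  by move=> h; rewrite inE => /orP[/eqP ->//|]; exact: h1.
apply: (is_derive_norm_le (is_derive_diff dg xO)).
apply: filterS (small x _ xO) => t [t1 tO].
have := H (t *: delta_mx 0 a :: hs) h0 x _ tO; rewrite /= hsl => /(_ erefl).
rewrite big_cons enorm_delta [x + _]addrC.
by rewrite [`|t| * _]mulrC !mulrA.
Unshelve. all: by end_near. Qed.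

Lemma normr_coord_le (R : realType) (n : nat) (v : 'rV[R]_n) (i : 'I_n) :
  `|v 0 i| <= `|v|.
Proof.
rewrite [`|v|]mx_normrE.
exact: (le_bigmax _ (fun ij : 'I_1 * 'I_n => `|v ij.1 ij.2|) (0, i)).
Qed.

Lemma enorm_le_norm (R : realType) (n : nat) (v : 'rV[R]_n) :
  enorm v <= n.+1%:R * `|v|.
Proof.
rewrite -ler_sqr ?nnegrE ?enorm_ge0 ?mulr_ge0// sqr_enorm.
apply: (@le_trans _ _ (\sum_(i < n) `|v| ^+ 2)).
  apply: ler_sum => i _; rewrite -real_normK ?num_real// ler_sqr ?nnegrE//.
  exact: normr_coord_le.
rewrite sumr_const card_ord -[leLHS]mulr_natl exprMn ler_wpM2r ?sqr_ge0//.
rewrite -natrX ler_nat; apply: (leq_trans (leqnSn n)).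
by rewrite -[leqLHS]expn1 leq_pexp2l.
Qed.

(** Second differences have the Hoelder form required by
    [differentiable_second_diff]: for [l = 0] by the second clause, and
    otherwise by the first one, as a length of at most one is bounded by its
    power alpha. *)
Lemma diff_bounded_differentiable (R : realType) (n : nat)
    (Omega : set 'rV[R]_n) (alpha : R) (l : nat) (N : R) (g : 'rV[R]_n -> R)
    (x : 'rV[R]_n) : 0 < alpha <= 1 -> 0 <= N ->
  open Omega -> diff_bounded Omega alpha l.+1 N g -> Omega x ->
  differentiable g x.
Proof.
move=> /andP[a0 a1] N0 oO [B H] Ox.
have [r /= r0 rO] : nbhs_ball x Omega by apply/nbhs_ballP; exact: open_nbhs_nbhs.
have inO y : `|y - x| < r -> Omega y.
  by move=> yr; apply: rO; rewrite -ball_normE /ball_ /= distrC.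
pose cn : R := n.+1%:R.
have cn0 : 0 < cn by rewrite ltr0n.
have cn1 : 1 <= cn by rewrite ler1n.
pose d := Num.min (r / 3) cn^-1.
have d0 : 0 < d by rewrite lt_min invr_gt0 cn0 divr_gt0.
have dr : d + d + d <= r.
  have : d <= r / 3 by rewrite ge_min lexx.
  by lra.
have h1 (h : 'rV[R]_n) : `|h| < d -> enorm h <= 1.
  move=> hd; apply: (le_trans (enorm_le_norm h)); rewrite -/cn mulrC.
  rewrite -ler_pdivlMr// mul1r ltW// (lt_le_trans hd)//.
  by rewrite ge_min lexx orbT.
apply: (@differentiable_second_diff _ _ g x (N * cn * cn) d alpha) => //.
- by rewrite !mulr_ge0// ltW.
- move=> y h yx hd; have hO : vertices_in Omega [:: h] y.
    split; apply: inO; last by rewrite (lt_le_trans yx)//; lra.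
    by rewrite addrAC (le_lt_trans (ler_normD _ _))//; lra.
  have := B [:: h] y isT _ hO; rewrite /= big_seq1 => /(_ _)/le_trans; apply.
    by move=> z; rewrite inE => /eqP ->; exact: h1.
  rewrite -mulrA -mulrA ler_wpM2l//; apply: (le_trans (enorm_le_norm h)).
  by rewrite -/cn ler_wpM2l ?(ltW cn0)// ler_peMl.
move=> h h' hd hd'.
have hO : vertices_in Omega [:: h; h'] x.
  split; split; apply: inO.
  - rewrite -[x + h + h']addrA [_ - x]addrC addKr.
    by rewrite (le_lt_trans (ler_normD _ _))//; lra.
  - by rewrite addrC addKr (lt_le_trans hd)//; lra.
  - by rewrite addrC addKr (lt_le_trans hd')//; lra.
  - by rewrite subrr normr0.
have pe : enorm h' `^ alpha <= cn * `|h'| `^ alpha.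
  apply: (@le_trans _ _ ((cn * `|h'|) `^ alpha)).
    apply: (ge0_ler_powR (ltW a0)); rewrite ?nnegrE ?enorm_ge0//.
      by rewrite mulr_ge0// ltW.
    exact: enorm_le_norm.
  by rewrite powRM ?(ltW cn0)// ler_wpM2r ?powR_ge0// ler1_powR.
have main : `|iterdiff [:: h; h'] g x| <= N * (enorm h' `^ alpha * enorm h).
  case: l B H => [|l] B H.
    by have := H [:: h] h' x erefl hO; rewrite big_seq1.
  apply: (le_trans (B [:: h; h'] x isT _ hO)).
    by move=> z; rewrite !inE => /orP[] /eqP ->; exact: h1.
  rewrite big_cons big_seq1 ler_wpM2l// mulrC ler_wpM2r ?enorm_ge0//.
  have [->|h'0] := eqVneq (enorm h') 0; first exact: powR_ge0.
  by apply: ger1_powR => //; rewrite h1// andbT lt_neqAle eq_sym h'0 enorm_ge0.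
rewrite (_ : _ + g x = iterdiff [:: h; h'] g x); last by rewrite /=; ring.
apply: (le_trans main); rewrite -!mulrA ler_wpM2l//.
rewrite (_ : cn * (cn * (`|h| * _)) = (cn * `|h'| `^ alpha) * (cn * `|h|));
  last by ring.
apply: ler_pM => //; rewrite ?powR_ge0 ?enorm_ge0//; exact: enorm_le_norm.
Qed.

Lemma diff_bounded_pderiv (R : realType) (n k : nat)
    (Omega : set 'rV[R]_n) (alpha : R) (N : R) (f : 'rV[R]_n -> R)
    (w : seq 'I_n) : 0 < alpha <= 1 -> 0 <= N ->
  open Omega -> diff_bounded Omega alpha k N f -> (size w <= k)%N ->
  diff_bounded Omega alpha (k - size w) N (pderiv w f).
Proof.
move=> a01 N0 oO fB; elim: w => [|a w IH] wk; first by rewrite subn0.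
have {}IH := IH (ltnW wk).
have E : (k - size w)%N = (k - size (a :: w)).+1 by rewrite /= subnSK.
rewrite E in IH; apply: diff_bounded_derive => // y Oy.
apply: diff_derivable; exact: (diff_bounded_differentiable a01 N0 oO IH).
Qed.

Lemma diff_bounded_norm (R : realType) (n l : nat) (Omega : set 'rV[R]_n)
    (alpha N : R) (g : 'rV[R]_n -> R) (x : 'rV[R]_n) :
  diff_bounded Omega alpha l N g -> Omega x -> `|g x| <= N.
Proof.
move=> [B _] Ox; have := B [::] x isT _ Ox; rewrite big_nil mulr1; apply.
by [].
Qed.

Lemma diff_bounded_holder0 (R : realType) (n : nat) (Omega : set 'rV[R]_n)
    (alpha N : R) (g : 'rV[R]_n -> R) (x y : 'rV[R]_n) :
  diff_bounded Omega alpha 0 N g -> Omega x -> Omega y ->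
  `|g x - g y| <= N * enorm (x - y) `^ alpha.
Proof.
move=> [_ H] Ox Oy; have := H [::] (x - y) y erefl.
by rewrite big_nil mulr1 /= addrC subrK; apply.
Qed.

(** For close points, from a first or a Hoelder difference; for distant ones,
    from the bound of [g]. *)
Lemma diff_bounded_holder (R : realType) (n l : nat) (Omega : set 'rV[R]_n)
    (alpha N : R) (g : 'rV[R]_n -> R) (x y : 'rV[R]_n) :
  0 < alpha <= 1 -> 0 <= N ->
  diff_bounded Omega alpha l N g -> Omega x -> Omega y ->
  `|g x - g y| <= 2 * N * enorm (x - y) `^ alpha.
Proof.
move=> /andP[a0 a1] N0 gB Ox Oy; case: l gB => [|l] gB.
  apply: (le_trans (diff_bounded_holder0 gB Ox Oy)).
  by rewrite -mulrA ler_peMl ?mulr_ge0 ?powR_ge0// ler1n.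
have [xy|xy] := leP (enorm (x - y)) 1.
  have [B _] := gB; have := B [:: x - y] y isT.
  rewrite big_seq1 /= [y + _]addrC subrK => H.
  have {}H : `|g x - g y| <= N * enorm (x - y).
    by apply: H => // z; rewrite inE => /eqP ->.
  apply: (le_trans H); rewrite -mulrA -[leLHS]mul1r ler_pM ?mulr_ge0 ?enorm_ge0//.
    by rewrite ler1n.
  rewrite ler_wpM2l//.
  have [->|e0] := eqVneq (enorm (x - y)) 0; first exact: powR_ge0.
  by apply: ger1_powR => //; rewrite xy andbT lt_neqAle eq_sym e0 enorm_ge0.
apply: (@le_trans _ _ (2 * N)).
  apply: (le_trans (ler_normB _ _)); rewrite mulr_natl mulr2n.
  by rewrite lerD// (diff_bounded_norm gB).
rewrite ler_peMr ?mulr_ge0//.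
have -> : 1 = 1 `^ alpha :> R by rewrite powR1.
by apply: (ge0_ler_powR (ltW a0)); rewrite ?nnegrE ?enorm_ge0// ltW.
Qed.

(** * Hoelder extension to the closure *)

(** For a fraction [c] of [0, 1], [c <= c `^ alpha]; apply this to the shares
    of [a] and [b] in [a + b]. *)
Lemma powR_subadditive (R : realType) (a b alpha : R) :
  0 <= a -> 0 <= b -> 0 < alpha <= 1 ->
  (a + b) `^ alpha <= a `^ alpha + b `^ alpha.
Proof.
move=> a0 b0 /andP[al0 al1].
have [s0|s0] := eqVneq (a + b) 0.
  by rewrite s0 powR0 ?gt_eqF// addr_ge0 ?powR_ge0.
have sp : 0 < a + b by rewrite lt_neqAle eq_sym s0 addr_ge0.
have part c : 0 <= c <= a + b -> c / (a + b) * (a + b) `^ alpha <= c `^ alpha.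
  move=> /andP[c0 cab].
  rewrite -{2}[c](divfK s0) powRM ?divr_ge0 ?(ltW sp)//.
  rewrite ler_wpM2r ?powR_ge0//.
  have [->|cn0] := eqVneq c 0; first by rewrite mul0r powR_ge0.
  have cp : 0 < c by rewrite lt_neqAle eq_sym cn0.
  by apply: ger1_powR => //; rewrite divr_gt0//= ler_pdivrMr// mul1r.
have Ha := part a; have Hb := part b.
rewrite -[leLHS]mul1r -{1}(divff s0) [X in X * _]mulrDl mulrDl.
by apply: lerD; [apply: Ha|apply: Hb]; rewrite ?a0 ?b0 ?lerDl ?lerDr.
Qed.

(** McShane's extension: the lower envelope of the cusps at the points of the
    domain. *)
Lemma holder_extension (R : realType) (V : normedModType R) (Omega : set V)
    (alpha K : R) (g : V -> R) : 0 < alpha <= 1 -> 0 <= K ->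
  (forall x y, Omega x -> Omega y -> `|g x - g y| <= K * `|x - y| `^ alpha) ->
  exists2 G : V -> R, forall x, Omega x -> G x = g x &
    forall x y, `|G x - G y| <= K * `|x - y| `^ alpha.
Proof.
move=> a01 K0 gK.
have [->|nO] := eqVneq Omega set0.
  exists (fun=> 0) => // x y; by rewrite subrr normr0 mulr_ge0// powR_ge0.
move/set0P: nO => [p Op].
pose S x := [set g y + K * `|x - y| `^ alpha | y in Omega]%classic.
have tri x y z : K * `|x - z| `^ alpha <=
  K * `|x - y| `^ alpha + K * `|y - z| `^ alpha.
  rewrite -mulrDr ler_wpM2l//; apply: le_trans (powR_subadditive _ _ a01) => //.
  apply: ge0_ler_powR; rewrite ?nnegrE ?addr_ge0//.
    by case/andP: a01 => /ltW.
  exact: ler_distD.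
have lbS x : lbound (S x) (g p - K * `|p - x| `^ alpha).
  move=> _ [y Oy <-]; rewrite lerBlDr -addrA -lerBlDl.
  apply: (le_trans (ler_norm _)); apply: (le_trans (gK _ _ Op Oy)).
  by rewrite addrC; exact: tri.
have hS x : has_lbound (S x) by exists (g p - K * `|p - x| `^ alpha).
have nS x : (S x !=set0)%classic by exists (g p + K * `|x - p| `^ alpha); exists p.
exists (fun x => inf (S x)) => [x Ox|x y].
  apply/eqP; rewrite eq_le; apply/andP; split.
    apply: ge_inf => //; exists x => //; rewrite subrr normr0 powR0 ?mulr0 ?addr0//.
    by rewrite gt_eqF//; case/andP: a01.
  apply: lb_le_inf => // _ [y Oy <-]; rewrite -lerBlDl.
  by apply: (le_trans (ler_norm _)); exact: gK.
have half u v : inf (S u) <= inf (S v) + K * `|u - v| `^ alpha.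
  rewrite -lerBlDr; apply: lb_le_inf => // _ [z Oz <-].
  rewrite lerBlDr -addrA; apply: (@le_trans _ _ (g z + K * `|u - z| `^ alpha)).
    by apply: ge_inf => //; exists z.
  by rewrite lerD2l addrC; exact: tri.
by rewrite ler_distl lerBlDr half/= distrC half.
Qed.

Lemma holder_continuous (R : realType) (V W : normedModType R)
    (alpha K : R) (G : V -> W) : 0 < alpha -> 0 <= K ->
  (forall x y, `|G x - G y| <= K * `|x - y| `^ alpha) -> continuous G.
Proof.
move=> a0 K0 GK x; apply/cvgrPdist_le => e e0.
pose eta := (e / (K + 1)) `^ alpha^-1.
have K1 : 0 < K + 1 by rewrite ltr_wpDl.
have eta0 : 0 < eta by rewrite powR_gt0// divr_gt0.
apply/nbhs_ballP; exists eta => //= y; rewrite -ball_normE /ball_/= => xy.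
apply: (le_trans (GK x y)).
have : `|x - y| `^ alpha <= e / (K + 1).
  apply: (@le_trans _ _ (eta `^ alpha)).
    by apply: (ge0_ler_powR (ltW a0)); rewrite ?nnegrE// ltW.
  by rewrite -powRrM mulVf ?gt_eqF// powRr1// divr_ge0// ltW.
move=> H; apply: (@le_trans _ _ (K * (e / (K + 1)))).
  by rewrite ler_wpM2l.
by rewrite mulrA ler_pdivrMr// mulrC ler_pM2l// lerDl.
Qed.

Lemma norm_row_le (R : realType) (p : nat) (v : 'rV[R]_p) (B : R) : 0 <= B ->
  (forall i, `|v 0 i| <= B) -> `|v| <= B.
Proof.
move=> B0 vB; rewrite [`|v|]mx_normrE; apply: bigmax_le => // -[i j] _ /=.
by rewrite (ord1 i).
Qed.

Lemma enorm_row_le (R : realType) (p : nat) (v : 'rV[R]_p) (B : R) : 0 <= B ->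
  (forall i, `|v 0 i| <= B) -> enorm v <= p.+1%:R * B.
Proof.
move=> B0 vB; apply: (le_trans (enorm_le_norm v)).
by rewrite ler_wpM2l//; exact: norm_row_le.
Qed.

(** The coordinates are extended one at a time; a point of the closure is
    within distance one of the domain, so the extension is bounded there. *)
Lemma holder_bounded_extension (R : realType) (n p : nat)
    (Omega : set 'rV[R]_n) (F : 'rV[R]_n -> 'rV[R]_p) (alpha K N : R) :
  0 < alpha <= 1 -> 0 <= K -> 0 <= N ->
  (forall x i, Omega x -> `|F x 0 i| <= N) ->
  (forall x y i, Omega x -> Omega y ->
     `|F x 0 i - F y 0 i| <= K * `|x - y| `^ alpha) ->
  bounded_extension Omega F /\ {within Omega, continuous F}%classic.
Proof.
move=> a01 K0 N0 FN FK; have a0 : 0 < alpha by case/andP: a01.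
have ext i : exists G : 'rV[R]_n -> R, (forall x, Omega x -> G x = F x 0 i) /\
    forall x y, `|G x - G y| <= K * `|x - y| `^ alpha.
  have [G G1 G2] := holder_extension a01 K0 (fun x y => FK x y i).
  by exists G.
have [G HG] := choice ext.
pose g x : 'rV[R]_p := \row_i G i x.
have gF x : Omega x -> g x = F x.
  by move=> Ox; apply/rowP => i; rewrite mxE (HG i).1.
have gK x y : `|g x - g y| <= K * `|x - y| `^ alpha.
  apply: norm_row_le => [|i]; first by rewrite mulr_ge0 ?powR_ge0.
  by rewrite !mxE; exact: (HG i).2.
have cg : continuous g := holder_continuous a0 K0 gK.
split.
  exists g; split=> //; first exact: continuous_subspaceT.
  apply: (@le_lt_trans _ _ (p.+1%:R * (N + K))%:E); last exact: ltry.
  apply: supE_le => [|x xO]; first by rewrite lee_fin mulr_ge0// addr_ge0.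
  have [y [Oy xy]] := xO _ (nbhsx_ballx x 1 ltr01).
  rewrite lee_fin; apply: enorm_row_le => [|i]; first by rewrite addr_ge0.
  rewrite -(subrK (g y 0 i) (g x 0 i)) addrC; apply: (le_trans (ler_normD _ _)).
  apply: lerD; first by rewrite gF// FN.
  rewrite !mxE; apply: (le_trans ((HG i).2 x y)); rewrite ler_piMr//.
  have -> : 1 = 1 `^ alpha :> R by rewrite powR1.
  apply: (ge0_ler_powR (ltW a0)); rewrite ?nnegrE//.
  by move: xy; rewrite -ball_normE /ball_/= => /ltW.
apply: (@subspace_eq_continuous _ Omega _ g F); last exact: continuous_subspaceT.
by move=> x; rewrite inE => Ox; rewrite gF.
Qed.

(** * The two embeddings *)

Lemma Cb_of_diff_bounded (R : realType) (n k : nat) (alpha : R) :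
  0 < alpha <= 1 ->
  exists2 C : R, 0 <= C &
    forall (Omega : set 'rV[R]_n) (f : 'rV[R]_n -> R) (N : R), 0 <= N ->
      open Omega -> diff_bounded Omega alpha k N f ->
      carrier (Cb k alpha Omega) f /\
      (fnorm (Cb k alpha Omega) f <= (C * N)%:E)%E.
Proof.
move=> a01; have /andP[a0 a1] := a01.
pose q j : R := #|{: j.-tuple 'I_n}|.+1%:R.
have q0 j : 0 <= q j by rewrite ler0n.
exists (1 + (\sum_(1 <= j < k.+1) q j + q k)).
  by rewrite addr_ge0// addr_ge0// sumr_ge0.
move=> Omega f N N0 oO fN.
have gN (w : seq 'I_n) : (size w <= k)%N ->
    diff_bounded Omega alpha (k - size w) N (pderiv w f).
  by move=> wk; exact: (diff_bounded_pderiv a01 N0 oO fN wk).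
have size_t j t : size (enum_val t : j.-tuple 'I_n) = j by rewrite size_tuple.
have cN j x t : (j <= k)%N -> Omega x -> `|nabla j f x 0 t| <= N.
  move=> jk Ox; rewrite mxE; apply: (diff_bounded_norm (gN _ _) Ox).
  by rewrite size_t.
have nablaN j x : (j <= k)%N -> Omega x -> enorm (nabla j f x) <= q j * N.
  by move=> jk Ox; apply: enorm_row_le => // t; exact: cN.
have nab j : (j <= k)%N -> (sup_norm Omega (nabla j f) <= (q j * N)%:E)%E.
  move=> jk; apply: supE_le => [|x Ox]; first by rewrite lee_fin mulr_ge0.
  by rewrite lee_fin; exact: nablaN.
have hol : (holder alpha Omega (nabla k f) <= (q k * N)%:E)%E.
  apply: supE_le => [|[x y] /= [Ox Oy /eqP xy]]; first by rewrite lee_fin mulr_ge0.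
  have e0 : 0 < enorm (x - y) by rewrite lt_neqAle eq_sym enorm_eq0 subr_eq0 xy
    enorm_ge0.
  rewrite lee_fin ler_pdivrMr ?powR_gt0// -mulrA.
  apply: enorm_row_le => [|t]; first by rewrite mulr_ge0 ?powR_ge0.
  rewrite !mxE; apply: diff_bounded_holder0 Ox Oy.
  by have := gN (enum_val t : k.-tuple 'I_n); rewrite size_t subnn; apply.
have fsup : (sup_abs Omega f <= N%:E)%E.
  apply: supE_le => [|x Ox]; first by rewrite lee_fin.
  by rewrite lee_fin; exact: (diff_bounded_norm fN Ox).
have ext j : (j <= k)%N -> bounded_extension Omega (nabla j f) /\
    {within Omega, continuous (nabla j f)}%classic.
  move=> jk.
  apply: (@holder_bounded_extension _ _ _ _ _ alpha (2 * N * n.+1%:R) N) => //.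
  - by rewrite !mulr_ge0.
  - by move=> x t Ox; exact: cN.
  move=> x y t Ox Oy; rewrite !mxE.
  have := gN (enum_val t : j.-tuple 'I_n); rewrite size_t => /(_ jk) gw.
  apply: (le_trans (diff_bounded_holder a01 N0 gw Ox Oy)).
  rewrite -[leRHS]mulrA ler_wpM2l ?mulr_ge0//.
  apply: (@le_trans _ _ ((n.+1%:R * `|x - y|) `^ alpha)).
    apply: (ge0_ler_powR (ltW a0)); rewrite ?nnegrE ?enorm_ge0 ?mulr_ge0//.
    exact: enorm_le_norm.
  by rewrite powRM// ler_wpM2r ?powR_ge0// ler1_powR// ler1n.
have dif j : (j < k)%N -> forall x, Omega x -> differentiable (nabla j f) x.
  move=> jk x Ox.
  have -> : nabla j f = (fun y => \sum_(t < #|{: j.-tuple 'I_n}|)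
      pderiv (enum_val t : j.-tuple 'I_n) f y *: delta_mx 0 t).
    apply/funext => y; rewrite [LHS]row_sum_delta.
    by apply: eq_bigr => t _; rewrite mxE.
  have -> : (fun y => \sum_(t < #|{: j.-tuple 'I_n}|)
      pderiv (enum_val t : j.-tuple 'I_n) f y *: delta_mx 0 t : 'rV[R]_ _) =
    \sum_(t < #|{: j.-tuple 'I_n}|) (fun y =>
      pderiv (enum_val t : j.-tuple 'I_n) f y *: (delta_mx 0 t : 'rV[R]_ _)).
    by apply/funext => y; rewrite fct_sumE.
  apply: differentiable_sum => t; apply: differentiableZl.
  have := gN (enum_val t : j.-tuple 'I_n); rewrite size_t => /(_ (ltnW jk)).
  by rewrite -(subnSK jk) => gw;
    exact: (diff_bounded_differentiable a01 N0 oO gw Ox).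
split.
  split; last by move=> j /ext[].
  split.
  - by split=> // j /ext[].
  - by move=> j /andP[_ jk]; rewrite (le_lt_trans (nab j jk))// ltry.
  - by rewrite (le_lt_trans hol)// ltry.
rewrite mulrDl mul1r EFinD /=; apply: leeD => //.
rewrite mulrDl EFinD; apply: leeD => //.
rewrite mulr_suml -sumEFin big_nat [leRHS]big_nat.
by apply: lee_sum => j /andP[_ jk]; exact: nab.
Qed.

(** Since the infimum over the gradients need not be attained, the estimate is
    made with gradients whose supremum is arbitrarily close to it. *)
Lemma MLinf_embeds_Cb (R : realType) (n k : nat) (alpha : R)
    (Omega : set 'rV[R]_n) : 0 < alpha <= 1 -> open Omega ->
  embeds (MLinf k (k%:R + alpha) Omega) (Cb k alpha Omega).
Proof.
move=> a01 oO.
have [C C0 HC] := Cb_of_diff_bounded n k a01.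
have [K K0 HK] := Dgrad_diff_le n k a01.
have key f G (a c : R) : 0 <= a -> 0 <= c ->
    (sup_abs Omega f <= a%:E)%E -> Dgrad k (k%:R + alpha) Omega f G ->
    (supE Omega G <= c%:E)%E ->
    carrier (Cb k alpha Omega) f /\
    (fnorm (Cb k alpha Omega) f <= (C * (a + K * c))%:E)%E.
  move=> a0 c0 fa fG Gc.
  have Kc0 : 0 <= K * c by rewrite mulr_ge0.
  have N0 : 0 <= a + K * c by rewrite addr_ge0.
  have [H1 H2] := HK Omega f G c c0 fG (fun y Oy => le_trans (supE_ub G Oy) Gc).
  apply: HC => //; split=> [hs x hsk h1 xO|hs h0 x hsk xO].
    have p0 : 0 <= \prod_(h <- hs) enorm h by rewrite prodr_ge0// => *;
      exact: enorm_ge0.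
    case: hs => [|h hs] in hsk h1 xO p0 *.
      rewrite big_nil mulr1 /= -lee_fin.
      apply: (@le_trans _ _ (sup_abs Omega f)).
        exact: (supE_ub (fun x => `|f x|%:E) xO).
      by rewrite (le_trans fa)// lee_fin lerDl.
    by apply: (le_trans (H1 _ x _ h1 xO)) => //; rewrite ler_wpM2r// lerDr.
  apply: (le_trans (H2 _ h0 x hsk xO)); rewrite ler_wpM2r ?lerDr//.
  by rewrite mulr_ge0 ?powR_ge0// prodr_ge0// => *; exact: enorm_ge0.
have fin_ge0 (y : \bar R) : (0 <= y)%E -> (y < +oo)%E ->
  exists2 r : R, 0 <= r & y = r%:E.
  by case: y => [r||]//; rewrite lee_fin => r0 _; exists r.
split=> [f [fa [G [fG Gc]]]|].
  have [a a0 ea] := fin_ge0 _ (supE_ge0 Omega (fun x => `|f x|%:E)) fa.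
  have [c c0 ec] := fin_ge0 _ (supE_ge0 Omega G) Gc.
  by have [] := key f G a c a0 c0 _ fG _; rewrite /sup_abs ?ea ?ec.
exists (C * (1 + K)) => f [fa [G0 [fG0 G0c]]].
have [a a0 ea] := fin_ge0 _ (supE_ge0 Omega (fun x => `|f x|%:E)) fa.
set S := (supE Omega @` Dgrad k (k%:R + alpha) Omega f)%classic.
have inf0 : (0 <= ereal_inf S)%E.
  by apply: le_ereal_inf_tmp => _ [G _ <-]; exact: supE_ge0.
have infy : (ereal_inf S < +oo)%E.
  by apply: le_lt_trans G0c; apply: ereal_inf_lbound; exists G0.
have [i i0 ei] := fin_ge0 _ inf0 infy.
have -> : fnorm (MLinf k (k%:R + alpha) Omega) f = (a + i)%:E.
  by rewrite /= /sup_abs ea -/S ei.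
rewrite -EFinM; apply/lee_addgt0Pr => e e0.
(* An excess of [e / (C * K + 1)] over the infimum costs at most [e]. *)
have CK1 : 0 < C * K + 1 by rewrite ltr_wpDl// mulr_ge0.
have e'0 : 0 < e / (C * K + 1) by rewrite divr_gt0.
have infin : ereal_inf S \is a fin_num by rewrite ei.
have [_ [G fG <-] Gi] := lb_ereal_inf_adherent e'0 infin.
have c0 : 0 <= i + e / (C * K + 1) by rewrite addr_ge0// ltW.
have Ha : (sup_abs Omega f <= a%:E)%E by rewrite /sup_abs ea.
have Hc : (supE Omega G <= (i + e / (C * K + 1))%:E)%E.
  by apply: ltW; rewrite EFinD -ei.
have [_ H] := key f G a _ a0 c0 Ha fG Hc.
apply: (le_trans H).
rewrite -EFinD lee_fin.
have -> : C * (a + K * (i + e / (C * K + 1))) =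
    C * (a + K * i) + C * K * (e / (C * K + 1)) by ring.
apply: lerD; last first.
  by rewrite mulrA ler_pdivrMr// mulrC ler_pM2l// lerDl.
rewrite -mulrA ler_wpM2l//; nra.
Qed.

Theorem theorem4p35 (R : realType) (n k : nat) (alpha : R)
    (Omega : set 'rV[R]_n) :
  (0 < n)%N -> (0 < k)%N -> 0 < alpha <= 1 -> open Omega ->
  embeds (MLinf k (k%:R + alpha) Omega) (Cb k alpha Omega) /\
  ((exists E, bounded_extension_operator k alpha Omega E) ->
   same_space (Cb k alpha Omega) (MLinf k (k%:R + alpha) Omega)).
Proof.
move=> _ _ a01 oO; have MC := MLinf_embeds_Cb k a01 oO.
split=> // hE; split=> //; apply: Cb_embeds_MLinf => //.
by case/andP: a01.
Qed.
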